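(* Let $(\ell,\mu,\mathcal{F}_* )$ be a regression problem, $n\in\mathbb{N}$, and let $\mathcal{D}_n=\{(X_1,Y_1),\dots,(X_n,Y_n)\}\sim\mu^n$ be an i.i.d. training sample. Let $\mathcal{F}_n\subseteq\{\mathbb{X}\to\mathbb{R}\}$ be a hypothesis class, which may depend on $\mathcal{D}_n$, and let $f_n\in(\alpha,\beta)\text{-ERM}(\mathcal{F}_n)$. Let $\hat{\mathcal{F}}_n,\mathcal{F}\subseteq\{\mathbb{X}\to\mathbb{R}\}$ be two function classes, where $\hat{\mathcal{F}}_n$ may depend on $\mathcal{D}_n$, but $\mathcal{F}$ may depend on the sample only through its size $n$. Suppose that for some metric $\psi:\mathcal{F}\times\mathcal{F}\to[0,\infty)$, some $\gamma\in(0,1)$, some $f_*\in\operatorname{argmin}_{f\in\mathcal{F}_*}R_\mu(f)$, some $r_0\ge 0$, and $\mathcal{F}(r_0):=\{f\in\mathcal{F}: L_\mu(f,\mathcal{F}_* )>r_0/n\}$, the following conditions hold: (C1) $\hat{\mathcal{F}}_n\subseteq\mathcal{F}_n\subseteq\mathcal{F}$ holds with probability at least $1-\gamma/4$; (C2) there exists $B_*\ge 0$ such that $\mathbb{P}\{\inf_{f\in\hat{\mathcal{F}}_n}(L_n(f,f_* )+\beta(f))+\alpha\le B_*\}\ge 1-\gamma/4$; (C3) there exist $G:\mathbb{X}\times\mathbb{R}\to[0,\infty)$ and $T\ge 0$ such that $\mathcal{Z}(f,g)\le G(X,Y)\,\psi(f,g)$ a.s. for all $f,g\in\mathcal{F}(r_0)$,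 and $\mathbb{P}\{\mathbb{E}[G(X,Y)]+\frac1n\sum_{i=1}^n G(X_i,Y_i)\le T\}\ge 1-\gamma/4$; (C4) there exist $S\in(0,\infty]$ and $q\in\{1,2\}$ such that $\big\|\mathbb{E}[\mathcal{Z}(f,g)]-\mathcal{Z}(f,g)\big\|_{\Psi_q}\le S\,\psi(f,g)$ for all $f,g\in\mathcal{F}(r_0)$; (C5) there exist $r\in(0,1]$ and $\theta>0$ such that $$\sup_{f\in\mathcal{F}(r_0)}\mathbb{E}\Big[e^{(r/\theta)\mathbb{E}[\mathcal{Z}(f,f_* )]-(1/\theta)\mathcal{Z}(f,f_* )}\Big]\le 1.$$ Then for all $\epsilon\ge\delta\ge 0$, with probability at least $1-\gamma$, $$L_\mu(f_n,\mathcal{F}_* )\le\frac1r\left(\theta\,\frac{\mathcal{H}_\psi(\epsilon,\mathcal{F}(r_0))+\ln(4/\gamma)}{n}+\frac{32S}{\sqrt n}\int_\delta^\epsilon\Big(2\mathcal{H}_\psi(z,\mathcal{F}(r_0))+\ln\Big(\frac{32\epsilon}{z\gamma}\Big)\Big)^{1/q}dz+8\delta T+B_*\right)+\frac{r_0}{n}.$$ Furthermore, the result holds without (C4), that is, using $S=\infty$, $\epsilon=\delta$, and the convention $\infty\cdot 0=0$ (so that the integral term vanishes).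
   Context: A regression problem $(\ell,\mu,\mathcal{F}_* )$ consists of a loss function $\ell:\mathbb{R}\times\mathbb{R}\to[0,\infty)$, a probability distribution $\mu$ on $\mathbb{X}\times\mathbb{R}$ where $\mathbb{X}$ is a separable Hilbert space, and a reference class $\mathcal{F}_*\subseteq\{\mathbb{X}\to\mathbb{R}\}$ (the set of all functions from $\mathbb{X}$ to $\mathbb{R}$ is denoted $\{\mathbb{X}\to\mathbb{R}\}$). $(X,Y)\sim\mu$ denotes a generic pair; ''a.s.'' means almost surely. All sets and functions considered are assumed to be measurable as necessary. Risk: $R_\mu(f)=\mathbb{E}[\ell(Y,f(X))]$. Excess risk: $L_\mu(f,g)=R_\mu(f)-R_\mu(g)$ and $L_\mu(f,\mathcal{F}_* )=R_\mu(f)-\min_{g\in\mathcal{F}_*}R_\mu(g)$. For a random (data-dependent) $f_n$, $L_\mu(f_n,\mathcal{F}_* )$ means the value of $L_\mu(\cdot,\mathcal{F}_* )$ at the realized function $f_n$. Empirical risk: $R_n(f)=\frac1n\sum_{i=1}^n\ell(Y_i,f(X_i))$; empirical excess risk: $L_n(f,g)=R_n(f)-R_n(g)$. Put $\mathcal{Z}(f,g)=\ell(Y,f(X))-\ell(Y,g(X))$, so $L_\mu(f,g)=\mathbb{E}[\mathcal{Z}(f,g)]$. $f_n\in(\alpha,\beta)\text{-ERM}(\mathcal{F}_n)$ means: $f_n\in\mathcal{F}_n$ and $R_n(f_n)+\beta(f_n)\le\inf_{f\in\mathcal{F}_n}(R_n(f)+\beta(f))+\alpha$, where $\beta:\mathcal{F}_n\to[0,\infty)$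 is a penalty function and $\alpha\ge 0$ is an error term; $\alpha,\beta,\mathcal{F}_n$ may all depend on the sample $\mathcal{D}_n$. Orlicz norm: for $q\ge1$ and a real random variable $W$, $\|W\|_{\Psi_q}=\inf\{B>0:\mathbb{E}[e^{|W/B|^q}-1]\le1\}$ with $\inf\emptyset=\infty$. Entropy: for a nonempty metric space $(\mathcal{F},\psi)$ and $\epsilon\ge0$, the covering number $\mathcal{N}_\psi(\epsilon,\mathcal{F})$ is the smallest $k\in\mathbb{N}$ such that there are $f_1,\dots,f_k\in\mathcal{F}$ with $\sup_{f\in\mathcal{F}}\min_i\psi(f,f_i)\le\epsilon$ ($\infty$ if none exists), and $\mathcal{H}_\psi(\epsilon,\mathcal{F})=\ln\mathcal{N}_\psi(\epsilon,\mathcal{F})$.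
   Formalization: In (C3) the inequality Z(f,g) ≤ G(X,Y)ψ(f,g) is required almost surely simultaneously for all f,g in F(r_0) (one null set for all pairs); with a null set depending on the pair (f,g) the claim is false. *)

(* Defs.v *)
From HB Require Import structures.
From mathcomp Require Import all_boot all_order all_algebra.
From mathcomp Require Import sesquilinear.
From mathcomp Require Import all_classical all_reals all_analysis.

Set Implicit Arguments.
Unset Strict Implicit.
Unset Printing Implicit Defensive.

Import Order.TTheory GRing.Theory Num.Theory.
Import numFieldNormedType.Exports.

Local Open Scope classical_set_scope.
Local Open Scope ring_scope.
Local Open Scope ereal_scope.

Definition separable (X : topologicalType) : Prop :=
  exists D : set X, countable D /\ dense D.

Definition inner_product_norm (R : realType) (X : normedModType R)
    (ip : {dot X for idfun}) : Prop :=
  forall x : X, ip x x = (`|x| ^+ 2)%R.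

Notation borel X := (g_sigma_algebraType (@open X)).

Notation obs X R := (borel X * measurableTypeR R)%type.

(* "Probability at least p" for an event that need not be measurable: it holds
   on a measurable set of probability at least p.  For measurable E this is
   p%:E <= P E. *)
Definition with_prob_ge d (T : measurableType d) (R : realType)
    (P : probability T R) (p : R) (E : set T) : Prop :=
  exists A : set T, [/\ measurable A, p%:E <= P A & A `<=` E].

(* The joint law of the n entries of D is the n-fold product measure mu^n. *)
Definition iid_sample d (T : measurableType d) d' (Z : measurableType d')
    (R : realType) (P : probability T R) (mu : probability Z R) (n : nat)
    (D : T -> n.-tuple Z) : Prop :=
  measurable_fun setT D /\
  forall A : 'I_n -> set Z, (forall i, measurable (A i)) ->
    P [set w | forall i, A i (tnth (D w) i)] = \prod_(i < n) mu (A i).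

(* The infimum of the empty set is +oo. *)
Definition Orlicz_norm d (T : measurableType d) (R : realType)
    (P : probability T R) (q : R) (W : T -> R) : \bar R :=
  ereal_inf [set B%:E | B in
    [set B : R | (0 < B)%R /\
       'E_P[fun w => (expR (`|W w / B| `^ q) - 1)%R] <= 1]].

Definition metric_on (R : realType) (T : Type) (F : set T)
    (psi : T -> T -> R) : Prop :=
  [/\ forall f g, F f -> F g -> (0 <= psi f g)%R,
      forall f g, F f -> F g -> (psi f g = 0%R <-> f = g),
      forall f g, F f -> F g -> psi f g = psi g f &
      forall f g h, F f -> F g -> F h -> (psi f h <= psi f g + psi g h)%R].

Definition covering_number (R : realType) (T : Type) (psi : T -> T -> R)
    (eps : R) (F : set T) : \bar R :=
  ereal_inf [set k%:R%:E | k in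
    [set k : nat | exists c : 'I_k -> T, (forall i, F (c i)) /\
       forall f, F f -> exists i, (psi f (c i) <= eps)%R]].

(* The maximum with 1 only matters when F is empty: the covering number is then
   0, and the entropy is taken to be 0 rather than -oo. *)
Definition entropy (R : realType) (T : Type) (psi : T -> T -> R)
    (eps : R) (F : set T) : \bar R :=
  lne (maxe 1 (covering_number psi eps F)).

Section risk.
Context (R : realType) (X : ptopologicalType).
Variable ell : R -> R -> R.
Implicit Types (mu : probability (obs X R) R) (f g : X -> R).

Definition zdiff f g (z : obs X R) : R :=
  (ell z.2 (f z.1) - ell z.2 (g z.1))%R.

Definition risk mu f : \bar R := 'E_mu[fun z => ell z.2 (f z.1)].

(* As +oo - +oo is -oo in \bar R, every excess risk is -oo in the degenerate
   case where no function of Fs has finite risk. *)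
Definition excess_risk mu (Fs : set (X -> R)) f : \bar R :=
  risk mu f - ereal_inf [set risk mu g | g in Fs].

Definition argmin_risk mu (Fs : set (X -> R)) : set (X -> R) :=
  [set f | Fs f /\ forall g, Fs g -> risk mu f <= risk mu g].

Definition large_excess mu (Fs F : set (X -> R)) (c : R) : set (X -> R) :=
  [set f | F f /\ c%:E < excess_risk mu Fs f].

Context (n : nat).
Implicit Type d : n.-tuple (obs X R).

Definition emp_risk d f : R :=
  (n%:R^-1 * \sum_(i < n) ell (tnth d i).2 (f (tnth d i).1))%R.

Definition emp_excess d f g : R := (emp_risk d f - emp_risk d g)%R.

Definition ERM (a : R) (b : (X -> R) -> R) (Fn : set (X -> R)) d :
    set (X -> R) :=
  [set f | Fn f /\
     (emp_risk d f + b f)%:E <=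
       ereal_inf [set (emp_risk d g + b g)%:E | g in Fn] + a%:E].

End risk.

(* The convention 0 * +oo = 0 is that of \bar R, so the entropy integral term
   vanishes for S = +oo and eps = delta. *)
Definition excess_bound (R : realType) (T : Type) (psi : T -> T -> R)
    (F : set T) (n : nat) (gamma r0 Bs Tb r theta : R) (S : \bar R) (q : R)
    (eps delta : R) : \bar R :=
  (r^-1)%:E *
    (theta%:E * ((entropy psi eps F + (ln (4 / gamma))%:E) * (n%:R^-1)%:E)
     + 32%:E * S * ((Num.sqrt n%:R)^-1)%:E *
       \int[lebesgue_measure]_(z in `[delta, eps])
         (poweR (2%:E * entropy psi z F + (ln (32 * eps / (z * gamma)))%:E)
                q^-1)
     + (8 * delta * Tb)%:E + Bs%:E)
  + (r0 / n%:R)%:E.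

(* Main.v *)
Require Import Defs.
From HB Require Import structures.
From mathcomp Require Import all_boot all_order all_algebra.
From mathcomp Require Import sesquilinear finmap.
From mathcomp Require Import all_classical all_reals all_analysis.
From mathcomp Require Import measurable_realfun ring lra.

Set Implicit Arguments.
Unset Strict Implicit.
Unset Printing Implicit Defensive.

Import Order.TTheory GRing.Theory Num.Theory.
Import numFieldNormedType.Exports.

Local Open Scope classical_set_scope.
Local Open Scope ring_scope.
Local Open Scope ereal_scope.

(** Write the risk of [f = f_n] as the risk of a point [g] of an [eps]-net plus
    the difference of the two risks.  By (C5) and Markov's inequality, [r] times
    the excess risk of every net point is at most its empirical excess risk plus
    [theta * (H(eps) + ln (4 / gamma)) / n]; the deviation of the difference is
    chained along the scales [eps / 2^k], every link being controlled by (C4)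
    and the last one, at scale about [delta], by (C3); the empirical excess risk
    of [f_n] is at most [Bs] by (C2).

    Three points are not routine.  Since [r] may be less than 1, the net point
    [g] is a near minimizer of the risk in its cell, so that
    [r (R f - R g) <= R f - R g + eta]; this doubles the first scale.
    (C1), (C2) and (C3) already use up probability [3 gamma / 4], so the net
    and the chain have to share the remaining [gamma / 4]; the two exponential
    moments are therefore combined in a single convex combination before
    Markov's inequality is applied.  Finally [eta] is removed by passing to the
    upper limit of the events obtained for [eta = 1 / (m + 1)]. *)

(** * Independent samples *)

Section iid.
Import HBNNSimple.
Context d (T : measurableType d) d' (Z : measurableType d') (R : realType).
Variables (P : probability T R) (mu : probability Z R) (n : nat).
Variable D : T -> n.-tuple Z.
Hypothesis hD : iid_sample P mu D.

Lemma iid_measurable_tnth i : measurable_fun setT (fun w => tnth (D w) i).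
Proof.
case: hD => mD _.
exact: (measurableT_comp (measurable_tnth i) mD).
Qed.

Lemma iid_measurable_all (A : 'I_n -> set Z) : (forall i, measurable (A i)) ->
  measurable [set w | forall i, A i (tnth (D w) i)].
Proof.
move=> mA.
rewrite (_ : [set _ | _] =
  \bigcap_(i in [set: 'I_n]) ((fun w => tnth (D w) i) @^-1` A i)); last first.
  by apply/seteqP; split=> [w Aw i _|w Aw i]; [exact: Aw|exact: (Aw i)].
apply: fin_bigcap_measurable => // i _.
by rewrite -[X in measurable X]setTI; exact: iid_measurable_tnth.
Qed.

(** Distributivity turns the product of finite sums over level sets into a sum over assignments of a
    level to each observation. Each term carries the indicator of a box, whose probability factors
    by independence; distributivity backwards gives the n-th power. *)
Lemma iid_fimfun_prod (h : {nnsfun Z >-> R}) (M : R) :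
  \int[mu]_z (h z)%:E <= M%:E ->
  \int[P]_w (\prod_(i < n) h (tnth (D w) i))%:E <= (M ^+ n)%:E.
Proof.
move=> hM.
pose s := fset_set (h @` setT).
pose A (j : 'I_(#|` s|)) := h @^-1` [set s`_j].
have mA j : measurable (A j) by rewrite /A -[X in measurable X]setTI; exact: measurable_funP.
have s0 (j : 'I_(#|` s|)) : (0 <= s`_j)%R.
  have : s`_j \in s by exact/mem_nth.
  rewrite in_fset_set; first by move=> /set_mem [z _ <-].
  exact: fimfunP.
have hE z : h z = (\sum_(j < #|` s|) s`_j * \1_(A j) z)%R by rewrite {1}fimfunEord.
pose m j := fine (mu (A j)).
have mE j : mu (A j) = (m j)%:E by rewrite fineK ?fin_num_measure.
have m0 j : (0 <= m j)%R by exact: fine_ge0.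
have sM : (\sum_(j < #|` s|) s`_j * m j <= M)%R.
  rewrite -lee_fin (le_trans _ hM)//.
  under eq_integral do rewrite hE -sumEFin.
  rewrite ge0_integral_sum//; last 2 first.
  - move=> j; apply/measurable_EFinP; apply: measurable_funM;
      [exact: measurable_cst|exact: measurable_indic].
  - by move=> j z _; rewrite lee_fin mulr_ge0.
  rewrite -sumEFin; apply: lee_sum => j _.
  under eq_integral do rewrite EFinM.
  rewrite ge0_integralZl ?lee_fin//; last first.
    by apply/measurable_EFinP; exact: measurable_indic.
  by rewrite integral_indic// setIT EFinM /m fineK ?fin_num_measure.
apply: (@le_trans _ _ ((\sum_(j < #|` s|) s`_j * m j) ^+ n)%:E); last first.
  by rewrite lee_fin lerXn2r ?nnegrE// ?(le_trans _ sM)// sumr_ge0// => j _;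
    rewrite mulr_ge0.
have -> : ((\sum_(j < #|` s|) s`_j * m j) ^+ n = \sum_(f : {ffun 'I_n -> 'I_(#|` s|)})
    (\prod_i s`_(f i)) * \prod_i m (f i))%R.
  rewrite -[in LHS](card_ord n) -prodr_const bigA_distr_bigA/=.
  by apply: eq_bigr => f _; rewrite big_split.
have -> : (fun w => (\prod_(i < n) h (tnth (D w) i))%:E) =
    (fun w => \sum_(f : {ffun 'I_n -> 'I_(#|` s|)})
    ((\prod_i s`_(f i))%:E *
     (\1_([set w | forall i, A (f i) (tnth (D w) i)]) w)%:E)).
  apply/funext => w; under eq_bigr do rewrite hE.
  rewrite bigA_distr_bigA/= -sumEFin; apply: eq_bigr => f _.
  rewrite -EFinM big_split/=; congr (_ * _)%:E%R.
  rewrite [RHS]indicE; have [Af|Af] := pselect (forall i, A (f i) (tnth (D w) i)).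
    by rewrite mem_set// big1// => i _; rewrite indicE mem_set//; exact: Af.
  rewrite memNset//.
  move/existsNP: Af => [i Afi].
  by rewrite (bigD1 i)//= indicE memNset// mul0r.
rewrite ge0_integral_sum//; last 2 first.
- move=> f; apply/measurable_EFinP; apply: measurable_funM; first exact: measurable_cst.
  by apply: measurable_indic; exact: (iid_measurable_all (fun i => mA (f i))).
- by move=> f w _; rewrite -EFinM lee_fin mulr_ge0// prodr_ge0.
rewrite -sumEFin; apply: lee_sum => f _.
have mf : measurable [set w | forall i, A (f i) (tnth (D w) i)].
  exact: (iid_measurable_all (fun i => mA (f i))).
rewrite ge0_integralZl ?lee_fin ?prodr_ge0//; last first.
  by apply/measurable_EFinP; exact: measurable_indic.
rewrite integral_indic// setIT [X in _ * X](_ : _ = \prod_i mu (A (f i))); last first.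
  exact: (proj2 hD (fun i => A (f i))).
rewrite (eq_bigr (fun i => (m (f i))%:E)) => [|i _]; last exact: mE.
by rewrite prodEFin EFinM.
Qed.

(** Simple functions increase to [h], and so do their products; monotone convergence carries the
    bound over. *)
Lemma iid_integral_prod_le (h : Z -> R) (M : R) :
  (forall z, 0 <= h z)%R -> measurable_fun setT h ->
  \int[mu]_z (h z)%:E <= M%:E ->
  \int[P]_w (\prod_(i < n) h (tnth (D w) i))%:E <= (M ^+ n)%:E.
Proof.
move=> h0 mh hM.
have mh' : measurable_fun setT (EFin \o h) by exact/measurable_EFinP.
pose g := nnsfun_approx measurableT mh'.
have g0 k z : (0 <= g k z)%R by exact: fun_ge0.
have gnd k l z : (k <= l)%N -> (g k z <= g l z)%R.
  by move=> kl; have /lefP := nd_nnsfun_approx measurableT mh' kl; exact.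
have gh k z : (g k z <= h z)%R.
  rewrite -lee_fin.
  rewrite -[leRHS]/((EFin \o h) z).
  rewrite -(cvg_lim _ (cvg_nnsfun_approx measurableT mh' (fun z _ => h0 z) (I : setT z)))//.
  apply: lime_ge; first by apply: ereal_nondecreasing_is_cvgn => a b ab; rewrite lee_fin gnd.
  by near=> m; rewrite lee_fin gnd//; near: m; exists k.
have gcvg z : g ^~ z @ \oo --> h z.
  by have /fine_cvgP[] := cvg_nnsfun_approx measurableT mh' (fun z _ => h0 z) (I : setT z).
pose G k w := (\prod_(i < n) g k (tnth (D w) i))%:E.
have mG k : measurable_fun setT (G k).
  apply/measurable_EFinP; apply: measurable_prod => i _.
  by apply: measurableT_comp => //; exact: iid_measurable_tnth.
have Gcvg w : (G ^~ w) @ \oo --> (\prod_(i < n) h (tnth (D w) i))%:E.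
  apply: cvg_EFin; first exact: nearW.
  apply: cvg_big => [|i _]; last exact: gcvg.
  exact: mul_continuous.
have -> : (fun w => (\prod_(i < n) h (tnth (D w) i))%:E) = (fun w => limn (G ^~ w)).
  by apply/funext => w; apply/esym/cvg_lim => //; exact: Gcvg.
rewrite monotone_convergence//; last 2 first.
- by move=> k w _; rewrite lee_fin prodr_ge0.
- move=> w _ k l kl; rewrite lee_fin; apply: ler_prod => i _.
  by rewrite g0 gnd.
apply: lime_le; last first.
  apply: nearW => k; apply: iid_fimfun_prod; apply: le_trans hM.
  apply: ge0_le_integral => //= [z _||z _]; rewrite ?lee_fin//.
  by apply/measurable_EFinP.
apply: ereal_nondecreasing_is_cvgn => k l kl; apply: ge0_le_integral => //.
- by move=> w _; rewrite lee_fin prodr_ge0.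
- move=> w _; rewrite lee_fin; apply: ler_prod => i _.
  by rewrite g0 gnd.
Unshelve. all: by end_near. Qed.

End iid.

(** * Exponential inequalities *)

Section exponential_inequalities.
Context {R : realType}.
Implicit Types (s t x y : R).
Local Open Scope ring_scope.

(** [e1] and [e2] are the tangent of the exponential at [t * y], evaluated at [y] and at 0; the
    weights [t] and [1 - t] cancel the linear terms. *)
Lemma expR_convex t y : 0 <= t -> t <= 1 ->
  expR (t * y) <= 1 + t * (expR y - 1).
Proof.
move=> t0 t1.
have e1 : expR (t * y) * (1 + (1 - t) * y) <= expR y.
  rewrite [leRHS](_ : _ = expR (t * y) * expR ((1 - t) * y)).
    by rewrite ler_pM2l ?expR_gt0// expR_ge1Dx.
  by rewrite -expRD; congr expR; ring.
have e2 : expR (t * y) * (1 - t * y) <= 1.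
  rewrite [leRHS](_ : _ = expR (t * y) * expR (- (t * y))); last by rewrite expRxMexpNx_1.
  by rewrite ler_pM2l ?expR_gt0// expR_ge1Dx.
have t1' : 0 <= 1 - t by rewrite subr_ge0.
have := lerD (ler_wpM2l t0 e1) (ler_wpM2l t1' e2).
have -> : t * (expR (t * y) * (1 + (1 - t) * y)) +
  (1 - t) * (expR (t * y) * (1 - t * y)) = expR (t * y) by ring.
lra.
Qed.

(** Termwise comparison of power series: from degree 2 on, a power of [s] is at most [s ^+ 2]. The
    linear term is kept exact, so that it vanishes in the mean for a centred variable. *)
Lemma expR_second_order s x : 0 <= s -> s <= 1 ->
  expR (s * x) <= 1 + s * x + s ^+ 2 * (expR `|x| - 1 - `|x|).
Proof.
move=> s0 s1.
have ub N : series (exp_coeff (s * x)) N.+2 <=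
    1 + s * x + s ^+ 2 * (series (exp_coeff `|x|) N.+2 - 1 - `|x|).
  elim: N => [|N IH].
    rewrite /series/= !big_nat_recr//= big_geq// /exp_coeff/=.
    rewrite !expr0 !expr1 fact0 !divr1 [X in _ * (X + _ + _ - _ - _)]big_geq// !add0r; lra.
  rewrite !(seriesSr _ N.+2)/=.
  have : exp_coeff (s * x) N.+2 <= s ^+ 2 * exp_coeff `|x| N.+2.
    rewrite /exp_coeff/= mulrA ler_wpM2r ?invr_ge0//.
    rewrite (le_trans (ler_norm _))// normrX normrM (ger0_norm s0) exprMn.
    rewrite ler_wpM2r ?exprn_ge0//.
    by rewrite -[leRHS]mulr1 -addn2 exprD mulrC ler_wpM2l ?exprn_ge0// exprn_ile1.
  lra.
have c1 := @is_cvg_series_exp_coeff R (s * x).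
have c2 := @is_cvg_series_exp_coeff R `|x|.
have -> : 1 + s * x + s ^+ 2 * (expR `|x| - 1 - `|x|) = 
  limn (fun N => 1 + s * x + s ^+ 2 * (series (exp_coeff `|x|) N - 1 - `|x|)).
  apply/esym/cvg_lim => //; apply: cvgD; first exact: cvg_cst.
  apply: cvgM; first exact: cvg_cst.
  apply: cvgB; last exact: cvg_cst.
  by apply: cvgB; [exact: c2|exact: cvg_cst].
apply: ler_lim => //.
  apply: is_cvgD; first exact: is_cvg_cst.
  apply: is_cvgM; first exact: is_cvg_cst.
  apply: is_cvgB; last exact: is_cvg_cst.
  by apply: is_cvgB; [exact: c2|exact: is_cvg_cst].
have {}ub N : (2 <= N)%N -> series (exp_coeff (s * x)) N <=
    1 + s * x + s ^+ 2 * (series (exp_coeff `|x|) N - 1 - `|x|).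
  by case: N => [|[|N]] // _; exact: ub.
by near=> N; apply: ub; near: N; exists 2%N.
Unshelve. all: by end_near. Qed.

Lemma expR1_le3 : expR 1 <= 3 :> R.
Proof.
(* The sixth power of the right side is [expR (- 1)], and [(5/6) ^+ 6] exceeds 1/3. *)
have h : (5/6 : R) <= expR (- 6^-1) by apply: le_trans (expR_ge1Dx _); lra.
have : (5/6 : R) ^+ 6 <= expR (- 6^-1) ^+ 6 by rewrite lerXn2r ?nnegrE ?expR_ge0//; lra.
rewrite -expRM_natl (_ : 6%:R * - 6^-1 = - 1 :> R); last by field.
rewrite expRN => H.
have e0 : 0 < expR 1 :> R by exact: expR_gt0.
have : (3^-1 : R) <= (expR 1)^-1 by apply: le_trans H; lra.
by rewrite lef_pV2 ?posrE.
Qed.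

Lemma expR_le_addr_expR_sqr y : expR y <= y + expR (y ^+ 2).
Proof.
have := expR_ge1Dx (y ^+ 2).
have [y1|y1] := leP 1 y.
  have : expR y <= expR (y ^+ 2) by rewrite ler_expR expr2 ler_peMl//; lra.
  lra.
have [yN1|yN1] := leP y (-1).
  have : expR y <= 1 by rewrite expR_le1; lra.
  by nra.
have [->|y0] := eqVneq y 0; first by rewrite expr0n/= expR0; lra.
have y1' : `|y| <= 1 by rewrite ler_norml; lra.
(* With [s = |y|] and [x] the sign of [y] this reads [expR y <= 1 + y + y ^+ 2 * (expR 1 - 2)], and
   [expR 1 <= 3]. *)
have := expR_second_order (Num.sg y) (normr_ge0 y) y1'.
rewrite mulrC -numEsg real_normK ?num_real// normr_sg y0 /= => H.
have := expR1_le3; have := sqr_ge0 y; nra.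
Qed.

(* If [\sum_k U k <= H] then the first term is at least 1; otherwise concavity of
   [x |-> 1 - expR (- x)] bounds what the first term lacks by the second one. *)
Lemma chain_tail (K : nat) (lam a A : R) (U h rho : 'I_K -> R) :
  0 < lam -> (forall k, 0 < h k) -> (forall k, 3 <= rho k * h k) ->
  let tau := expR (- (lam * (\sum_k h k) / 3)) in
  a + 4 / 3 * (\sum_k h k) < A + \sum_k U k ->
  1 <= tau * expR (lam * (A - a)) +
       (1 - tau) * \sum_k expR (rho k * (U k - h k)).
Proof.
move=> lam0 h0 rh tau; set H := \sum_k h k => hA.
have H0 : 0 <= H by apply: sumr_ge0 => k _; exact/ltW.
have tau1 : tau <= 1 by rewrite /tau expR_le1 -/H oppr_le0 divr_ge0// mulr_ge0// ltW.
have S0 : 0 <= \sum_k expR (rho k * (U k - h k)) by apply: sumr_ge0 => k _; exact: expR_ge0.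
have [UH|HU] := leP (\sum_k U k) H.
  (* Here the assumption leaves [A - a > H / 3], which compensates the weight [tau]. *)
  have : 1 <= tau * expR (lam * (A - a)).
    rewrite /tau -expRD -[leLHS]expR0 ler_expR.
    have : 0 <= A - a - H / 3 by lra.
    move=> /(mulr_ge0 (ltW lam0)); rewrite -/H; lra.
  have : 0 <= (1 - tau) * \sum_k expR (rho k * (U k - h k)) by rewrite mulr_ge0// subr_ge0.
  lra.
set y := \sum_k U k - H.
have y0 : 0 < y by rewrite subr_gt0.
have S1 : 1 <= \sum_k expR (rho k * (U k - h k)).
  have [k hk] : exists k, h k < U k.
    apply/not_existsP => hU; move: HU; apply/negP; rewrite -leNgt.
    by apply: ler_sum => k _; rewrite leNgt; apply/negP; exact: hU.
  rewrite (bigD1 k)//= -[leLHS]addr0 lerD//; last by apply: sumr_ge0 => *; exact: expR_ge0.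
  rewrite -[leLHS]expR0 ler_expR mulr_ge0// ?subr_ge0 ?(ltW hk)//.
  by have := rh k; have := h0 k; nra.
have hH k : h k <= H.
  by rewrite /H (bigD1 k)//= lerDl; apply: sumr_ge0 => j _; exact/ltW.
have Hp : 0 < H.
  have [k _] : exists k, h k < U k.
    apply/not_existsP => hU; move: HU; apply/negP; rewrite -leNgt.
    by apply: ler_sum => k _; rewrite leNgt; apply/negP; exact: hU.
  exact: lt_le_trans (h0 k) (hH k).
(* Each term is at least [3 * (U k - h k) / H], by [expR x >= 1 + x] and
   [rho k >= 3 / h k >= 3 / H]. *)
have S2 : 3 * y / H <= \sum_k expR (rho k * (U k - h k)).
  rewrite /y /H -sumrB mulr_sumr mulr_suml; apply: ler_sum => k _; rewrite -/H.
  have [Uh|hU] := leP (U k) (h k).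
    apply: le_trans (expR_ge0 _); rewrite pmulr_lle0 ?invr_gt0//; lra.
  apply: le_trans (expR_ge1Dx _); rewrite ler_pdivrMr//.
  have r0 : 0 < rho k by have := rh k; have := h0 k; nra.
  have : 3 <= rho k * H by apply: le_trans (rh k) _; rewrite ler_pM2l.
  have : 0 < U k - h k by rewrite subr_gt0.
  nra.
(* For [y <= H / 3] a sum of at least 1 suffices; beyond, concavity leaves [1 - tau] at least the
   fraction [H / (3 * y)] of the left side, and [S2] makes up for it. *)
have key : 1 - expR (- (lam * y)) <= (1 - tau) * \sum_k expR (rho k * (U k - h k)).
  have [yH|Hy] := leP y (H / 3).
    apply: (@le_trans _ _ (1 - tau)); last by rewrite ler_peMr// subr_ge0.
    rewrite lerD2l lerN2 /tau ler_expR lerN2 -/H -mulrA.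
    by rewrite ler_pM2l.
  apply: (@le_trans _ _ ((1 - tau) * (3 * y / H))); last by rewrite ler_wpM2l// subr_ge0.
  have t0 : 0 <= H / (3 * y) by rewrite divr_ge0//; nra.
  have t1 : H / (3 * y) <= 1 by rewrite ler_pdivrMr; nra.
  have := expR_convex (- (lam * y)) t0 t1.
  rewrite (_ : H / (3 * y) * - (lam * y) = - (lam * H / 3)); last first.
    by field; rewrite gt_eqF.
  rewrite -/H -/tau => T.
  have : H / (3 * y) * (1 - expR (- (lam * y))) <= 1 - tau by lra.
  rewrite -(@ler_pM2r _ (3 * y / H)); last by rewrite divr_gt0//; nra.
  apply: le_trans; rewrite le_eqVlt; apply/orP; left; apply/eqP; field.
  by rewrite !gt_eqF.
have : expR (- (lam * y)) <= tau * expR (lam * (A - a)).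
  rewrite /tau -expRD ler_expR -/H.
  have : 0 <= A - a - (H / 3 - y) by rewrite /y; lra.
  move=> /(mulr_ge0 (ltW lam0)); lra.
lra.
Qed.

End exponential_inequalities.

(** * Events of large probability and exponential moments *)

Section with_prob_ge.
Context d (T : measurableType d) (R : realType) (P : probability T R).
Implicit Types (p q : R) (E : set T).

Lemma with_prob_geS p E E' : E `<=` E' -> with_prob_ge P p E ->
  with_prob_ge P p E'.
Proof. by move=> EE' [A [mA pA AE]]; exists A; split=> //; exact: subset_trans EE'. Qed.

Lemma with_prob_geW p q E : (q <= p)%R -> with_prob_ge P p E ->
  with_prob_ge P q E.
Proof.
move=> qp [A [mA pA AE]]; exists A; split=> //.
by apply: le_trans pA; rewrite lee_fin.
Qed.

Lemma with_prob_geT p : (p <= 1)%R -> with_prob_ge P p setT.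
Proof. by move=> p1; exists setT; split=> //; rewrite probability_setT lee_fin. Qed.

Lemma with_prob_geI p q E E' : with_prob_ge P p E -> with_prob_ge P q E' ->
  with_prob_ge P (p + q - 1) (E `&` E').
Proof.
move=> [A [mA pA AE]] [B [mB qB BE]]; exists (A `&` B); split.
- exact: measurableI.
- have PA := probability_setC P mA; have PB := probability_setC P mB.
  have mAB := measurableI _ _ mA mB.
  have := probability_setC P mAB; rewrite setCI.
  have : P (~` A `|` ~` B) <= P (~` A) + P (~` B).
    by apply: measureU2; exact: measurableC.
  rewrite PA PB => + h; rewrite h.
  rewrite -(fineK (fin_num_measure P _ mA)) -(fineK (fin_num_measure P _ mB)) in pA qB *.
  rewrite -(fineK (fin_num_measure P _ mAB)).
  move: pA qB; rewrite -!EFinB -!EFinD !lee_fin; lra.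
- by move=> w [/AE ? /BE ?].
Qed.

(** The tail unions of the measurable witnesses decrease to their upper limit and each contains a
    set of probability at least [p]; continuity from above concludes. Events for different [eta]
    come from different nets and need not be nested, hence the upper limit. *)
Lemma with_prob_ge_lim_sup p (E : (set T)^nat) :
  (forall m, with_prob_ge P p (E m)) -> with_prob_ge P p (lim_sup_set E).
Proof.
move=> /choice[A hA].
have mA m : measurable (A m) by case: (hA m).
have pA m : p%:E <= P (A m) by case: (hA m).
have AE m : A m `<=` E m by case: (hA m).
have mU k : measurable (\bigcup_(j >= k) A j) by exact: bigcup_measurable.
exists (lim_sup_set A); split.
- by apply: bigcap_measurable => // k _; exact: mU.
- have h : P (\bigcup_(j >= k) A j) @[k --> \oo] --> P (lim_sup_set A).
    apply: lim_sup_set_cvg => //.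
    by rewrite (le_lt_trans (probability_le1 _ (mU 0%N)))// ltry.
  rewrite -(cvg_lim _ h)//; apply: lime_ge; first by apply/cvg_ex; eexists; exact: h.
  apply: nearW => k; apply: (le_trans (pA k)); apply: le_measure; rewrite ?inE//.
  by move=> w Aw; exists k => //=.
- move=> w Aw k _; have [j kj Ajw] := Aw k I; exists j => //; exact: AE.
Qed.

Lemma with_prob_ge_markov p (f : T -> R) : (forall w, 0 <= f w)%R ->
  measurable_fun setT f -> \int[P]_w (f w)%:E <= p%:E ->
  with_prob_ge P (1 - p) [set w | (f w < 1)%R].
Proof.
move=> f0 mf fp.
have mA : measurable [set w | (f w < 1)%R].
  rewrite -[X in measurable X]setTI.
  have := mf measurableT `]-oo, 1%R[%classic (measurable_itv _).
  by congr measurable; apply/seteqP; split => w /=; rewrite in_itv/=.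
exists [set w | (f w < 1)%R]; split => //.
have -> : [set w | (f w < 1)%R] = ~` [set w | 1%:E <= `|(f w)%:E|].
  apply/seteqP; split => w /=; rewrite lee_fin ger0_norm//.
    by move=> fw; apply/negP; rewrite -ltNge.
  by move=> /negP; rewrite -ltNge.
have mC : measurable [set w | 1%:E <= `|(f w)%:E|].
  rewrite [X in measurable X](_ : _ = ~` [set w | (f w < 1)%R]); first exact: measurableC.
  apply/seteqP; split => w /=; rewrite lee_fin ger0_norm//.
    by move=> fw; apply/negP; rewrite -leNgt.
  by move=> /negP; rewrite -leNgt.
rewrite probability_setC// EFinB leeB//; apply: le_trans fp.
have mf' : measurable_fun setT (EFin \o f) by exact/measurable_EFinP.
have := @le_integral_abse _ _ _ P setT measurableT (EFin \o f) 1%R mf' ltr01.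
rewrite mul1e setTI; move/le_trans; apply.
rewrite le_eqVlt; apply/orP; left; apply/eqP.
by apply: eq_integral => w _ /=; rewrite ger0_norm.
Qed.

End with_prob_ge.

Section moment_generating_function.
Context d (Z : measurableType d) (R : realType) (mu : probability Z R).
Variable X : Z -> R.
Hypothesis iX : mu.-integrable setT (EFin \o X).
Hypothesis X0 : \int[mu]_z (X z)%:E = 0.

Let mX : measurable_fun setT X.
Proof. by apply/measurable_EFinP; exact: measurable_int iX. Qed.

(** The multiple of [X] integrates to zero, so a pointwise bound on an exponential, affine in [X]
    and in the Orlicz integrand [V], becomes a bound on its moment. *)
Lemma integral_le_affine (F V : Z -> R) (a c k : R) :
  (0 <= c)%R -> (0 <= k)%R ->
  (forall z, 0 <= F z)%R -> measurable_fun setT F ->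
  (forall z, 0 <= V z)%R -> measurable_fun setT V -> \int[mu]_z (V z)%:E <= 1 ->
  (forall z, F z <= a * X z + (c + k * V z))%R ->
  \int[mu]_z (F z)%:E <= (c + k)%:E.
Proof.
move=> c0 k0 F0 mF V0 mV V1 FV.
have mV' : measurable_fun setT (EFin \o V) by exact/measurable_EFinP.
have iV : mu.-integrable setT (EFin \o V).
  apply/integrableP; split => //.
  apply: le_lt_trans (ltry 1%R); apply: le_trans V1.
  rewrite le_eqVlt; apply/orP; left; apply/eqP.
  by apply: eq_integral => z _ /=; rewrite ger0_norm.
have iVk : mu.-integrable setT (fun z => k%:E * (V z)%:E).
  exact: integrableZl.
have ic : mu.-integrable setT (cst c%:E).
  exact: finite_measure_integrable_cst.
have icV : mu.-integrable setT (fun z => c%:E + k%:E * (V z)%:E).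
  exact: integrableD.
have iaX : mu.-integrable setT (fun z => a%:E * (X z)%:E).
  exact: integrableZl.
apply: (@le_trans _ _ (\int[mu]_z (a%:E * (X z)%:E + (c%:E + k%:E * (V z)%:E)))).
  apply: ge0_le_integral => //.
  - by move=> z _; rewrite lee_fin.
  - exact/measurable_EFinP.
  - exact: measurable_int (integrableD measurableT iaX icV).
  - by move=> z _; rewrite -!EFinM -!EFinD lee_fin.
rewrite integralD// integralD// integralZl// X0 mule0 add0e integralZl//.
rewrite integral_cst// [X in _ * X + _]probability_setT mule1 EFinD leeD2l//.
by rewrite -[leRHS]mule1 lee_wpmul2l.
Qed.

Lemma mgf_subexponential s : (0 <= s)%R -> (s <= 1)%R ->
  \int[mu]_z (expR `|X z| - 1)%:E <= 1 ->
  \int[mu]_z (expR (s * X z))%:E <= (expR (s ^+ 2))%:E.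
Proof.
move=> s0 s1 EX.
apply: (@le_trans _ _ (1 + s ^+ 2)%:E); last by rewrite lee_fin expR_ge1Dx.
apply: (@integral_le_affine _ (fun z => expR `|X z| - 1)%R s) => //.
- by rewrite exprn_ge0.
- by apply: measurableT_comp => //; exact: measurable_funM.
- apply: measurable_funB => //; do 2 apply: measurableT_comp => //.
move=> z; apply: le_trans (expR_second_order _ s0 s1) _.
have : (0 <= s ^+ 2 * `|X z|)%R by rewrite mulr_ge0// exprn_ge0.
lra.
Qed.

(** For [s <= 1], convexity bounds [expR (s ^+ 2 * X ^+ 2)] by an affine function of
    [expR (X ^+ 2)]. For [s > 1], [s * X <= s ^+ 2 / 4 + X ^+ 2] gives the moment bound
    [2 * expR (s ^+ 2 / 4)], and 2 is at most [expR (s ^+ 2)]; this is where 5/4 comes from. *)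
Lemma mgf_subgaussian s : (0 <= s)%R ->
  \int[mu]_z (expR (X z ^+ 2) - 1)%:E <= 1 ->
  \int[mu]_z (expR (s * X z))%:E <= (expR (5 / 4 * s ^+ 2))%:E.
Proof.
move=> s0 EX.
have mF : measurable_fun setT (fun z => expR (s * X z)).
  by apply: measurableT_comp => //; exact: measurable_funM.
have mV : measurable_fun setT (fun z => expR (X z ^+ 2) - 1)%R.
  apply: measurable_funB => //; apply: measurableT_comp => //; exact: measurable_funX.
have V0 z : (0 <= expR (X z ^+ 2) - 1)%R.
  by rewrite subr_ge0 -[leLHS]expR0 ler_expR sqr_ge0.
have ss := exprn_ge0 2 s0.
have [s1|s1] := leP s 1%R.
  apply: (@le_trans _ _ (1 + s ^+ 2)%:E).
    apply: (@integral_le_affine _ (fun z => expR (X z ^+ 2) - 1)%R s) => //.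
    - move=> z; apply: le_trans (expR_le_addr_expR_sqr _) _; rewrite lerD2l exprMn.
      by apply: expR_convex => //; rewrite exprn_ile1.
  rewrite lee_fin; apply: le_trans (expR_ge1Dx _) _; rewrite ler_expR; lra.
have e0 := expR_ge0 (s ^+ 2 / 4).
apply: (@le_trans _ _ (expR (s ^+ 2 / 4) + expR (s ^+ 2 / 4))%:E).
  apply: (@integral_le_affine _ (fun z => expR (X z ^+ 2) - 1)%R 0) => //.
  move=> z; rewrite mul0r add0r.
  have -> : (expR (s ^+ 2 / 4) + expR (s ^+ 2 / 4) * (expR (X z ^+ 2) - 1) =
    expR (s ^+ 2 / 4) * expR (X z ^+ 2))%R by ring.
  rewrite -expRD ler_expR; have := sqr_ge0 (s / 2 - X z); lra.
rewrite lee_fin (_ : (5 / 4 * s ^+ 2 = s ^+ 2 + s ^+ 2 / 4)%R); last by field.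
rewrite expRD -[leLHS]mulr2n -[leLHS]mulr_natl ler_wpM2r//.
apply: le_trans (expR_ge1Dx _).
have : (1 <= s ^+ 2)%R by rewrite exprn_ege1// ltW.
lra.
Qed.

End moment_generating_function.

Definition sample_mean (R : realType) (Z : Type) (n : nat) (phi : Z -> R)
    (d : n.-tuple Z) : R :=
  (n%:R^-1 * \sum_(i < n) phi (tnth d i))%R.

Section sample_mean.
Context d (T : measurableType d) d' (Z : measurableType d') (R : realType).
Variables (P : probability T R) (mu : probability Z R) (n : nat).
Hypothesis n0 : (0 < n)%N.
Variable D : T -> n.-tuple Z.
Hypothesis hD : iid_sample P mu D.

Lemma measurable_sample_mean (phi : Z -> R) : measurable_fun setT phi ->
  measurable_fun setT (fun w => sample_mean phi (D w)).
Proof.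
move=> mphi; apply: measurable_funM; first exact: measurable_cst.
apply: measurable_sum => i; apply: measurableT_comp => //.
exact: iid_measurable_tnth hD i.
Qed.

Lemma measurable_expR_sample_mean (phi : Z -> R) (rho c : R) :
  measurable_fun setT phi ->
  measurable_fun setT (fun w => expR (rho * (sample_mean phi (D w) - c))).
Proof.
move=> mphi; apply: measurableT_comp => //; apply: measurable_funM => //.
apply: measurable_funB; last exact: measurable_cst.
exact: measurable_sample_mean.
Qed.

Lemma mgf_sample_mean (phi : Z -> R) (rho c M : R) : measurable_fun setT phi ->
  \int[mu]_z (expR (rho / n%:R * phi z))%:E <= M%:E ->
  \int[P]_w (expR (rho * (sample_mean phi (D w) - c)))%:E <=
    (expR (- (rho * c)) * M ^+ n)%:E.
Proof.
move=> mphi hM.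
have -> : (fun w => (expR (rho * (sample_mean phi (D w) - c)))%:E) =
  (fun w => (expR (- (rho * c)))%:E *
     (\prod_(i < n) expR (rho / n%:R * phi (tnth (D w) i)))%:E).
  apply/funext => w; rewrite -EFinM; congr EFin.
  rewrite -expR_sum -expRD; congr expR.
  by rewrite -mulr_sumr /sample_mean; ring.
have mh : measurable_fun setT (fun z => expR (rho / n%:R * phi z)).
  by apply: measurableT_comp => //; exact: measurable_funM.
rewrite ge0_integralZl//.
- rewrite EFinM lee_wpmul2l ?lee_fin ?expR_ge0//.
  exact: (iid_integral_prod_le hD (fun z => expR_ge0 (rho / n%:R * phi z)) mh hM).
- apply/measurable_EFinP; apply: measurable_prod => i _.
  exact: (measurableT_comp mh (iid_measurable_tnth hD i)).
- by move=> w _; rewrite lee_fin prodr_ge0// => i _; exact: expR_ge0.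
Qed.

(* Bounding the two exceptional events separately would cost probability 2p:
   the weights tau and 1 - tau let them share the single budget p. *)
Lemma chain_deviation (N K : nat) (J : 'I_K -> finType) (A : 'I_N -> Z -> R)
    (U : forall k, J k -> Z -> R) (theta a p : R) (rho h M : 'I_K -> R) :
  (0 < theta)%R ->
  (forall g, measurable_fun setT (A g)) ->
  (forall g, \int[mu]_z (expR (theta^-1 * A g z))%:E <= 1) ->
  (N%:R * expR (- (n%:R / theta * a)) <= p)%R ->
  (forall k, 0 < h k)%R -> (forall k, 3 <= rho k * h k)%R ->
  (forall k j, measurable_fun setT (U k j)) ->
  (forall k j, \int[mu]_z (expR (rho k / n%:R * U k j z))%:E <= (M k)%:E) ->
  (\sum_k #|J k|%:R * (expR (- (rho k * h k)) * M k ^+ n) <= p)%R ->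
  with_prob_ge P (1 - p)
    [set w | forall g (j : forall k, J k),
      (sample_mean (A g) (D w) + \sum_k sample_mean (U k (j k)) (D w)
       <= a + 4 / 3 * \sum_k h k)%R].
Proof.
move=> th0 mA EA Np h0 rh mU EU Up.
have n0' : (n%:R != 0 :> R)%R by rewrite pnatr_eq0 -lt0n.
have lam0 : (0 < n%:R / theta)%R by rewrite divr_gt0// ltr0n.
set lam := (n%:R / theta)%R in lam0 Np.
pose tau := expR (- (lam * (\sum_k h k) / 3)).
have H0 : (0 <= \sum_k h k)%R by apply: sumr_ge0 => k _; exact/ltW.
have tau0 : (0 <= tau)%R by exact: expR_ge0.
have tau1 : (0 <= 1 - tau)%R.
  by rewrite subr_ge0 /tau expR_le1 oppr_le0 divr_ge0// mulr_ge0// ltW.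
pose f1 w := (\sum_g expR (lam * (sample_mean (A g) (D w) - a)))%R.
pose f2 w := (\sum_k \sum_(j : J k)
  expR (rho k * (sample_mean (U k j) (D w) - h k)))%R.
have f10 w : (0 <= f1 w)%R by apply: sumr_ge0 => *; exact: expR_ge0.
have f20 w : (0 <= f2 w)%R.
  by apply: sumr_ge0 => *; apply: sumr_ge0 => *; exact: expR_ge0.
have mf1 : measurable_fun setT f1.
  by apply: measurable_sum => g; exact: (measurable_expR_sample_mean _ _ (mA g)).
have mf2 : measurable_fun setT f2.
  apply: measurable_sum => k; apply: measurable_sum => j.
  exact: (measurable_expR_sample_mean _ _ (mU k j)).
have E1 : \int[P]_w (f1 w)%:E <= p%:E.
  under eq_integral do rewrite -sumEFin.
  rewrite ge0_integral_sum//; last first.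
    by move=> g; apply/measurable_EFinP; exact: (measurable_expR_sample_mean _ _ (mA g)).
  apply: le_trans (_ : (\sum_(g < N) expR (- (lam * a)))%:E <= _); last first.
    by rewrite lee_fin sumr_const card_ord -mulr_natl.
  rewrite -sumEFin; apply: lee_sum => g _.
  have := @mgf_sample_mean (A g) lam a 1 (mA g); rewrite expr1n mulr1; apply.
  rewrite (_ : (lam / n%:R = theta^-1)%R)//.
  by rewrite /lam; field; rewrite n0' gt_eqF.
have E2 : \int[P]_w (f2 w)%:E <= p%:E.
  under eq_integral do rewrite -sumEFin.
  rewrite ge0_integral_sum//; last 2 first.
  - move=> k; apply/measurable_EFinP; apply: measurable_sum => j.
    exact: (measurable_expR_sample_mean _ _ (mU k j)).
  - by move=> k w _; rewrite lee_fin; apply: sumr_ge0 => *; exact: expR_ge0.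
  apply: (@le_trans _ _
      (\sum_k #|J k|%:R * (expR (- (rho k * h k)) * M k ^+ n))%:E); last first.
    by rewrite lee_fin.
  rewrite -sumEFin; apply: lee_sum => k _.
  under eq_integral do rewrite -sumEFin.
  rewrite ge0_integral_sum//; last first.
    by move=> j; apply/measurable_EFinP; exact: (measurable_expR_sample_mean _ _ (mU k j)).
  apply: le_trans (_ : (\sum_(j : J k) expR (- (rho k * h k)) * M k ^+ n)%:E <= _); last first.
    by rewrite lee_fin sumr_const -[leLHS]mulr_natl.
  rewrite -sumEFin; apply: lee_sum => j _.
  exact: mgf_sample_mean.
pose f w := (tau * f1 w + (1 - tau) * f2 w)%R.
have f0 w : (0 <= f w)%R by rewrite addr_ge0// mulr_ge0.
have mf : measurable_fun setT f.
  by apply: measurable_funD; apply: measurable_funM.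
apply: (@with_prob_geS _ _ _ _ _ [set w | (f w < 1)%R]); last first.
  apply: with_prob_ge_markov => //.
  under eq_integral do rewrite EFinD !EFinM.
  have mf1' : measurable_fun setT (EFin \o f1) by exact/measurable_EFinP.
  have mf2' : measurable_fun setT (EFin \o f2) by exact/measurable_EFinP.
  rewrite ge0_integralD// => [|w _||w _|]; rewrite -?EFinM ?lee_fin ?mulr_ge0//;
    [|exact: measurable_funeM|exact: measurable_funeM].
  rewrite !ge0_integralZl// => [|w _|w _]; rewrite ?lee_fin//.
  apply: (@le_trans _ _ (tau%:E * p%:E + (1 - tau)%:E * p%:E)).
    by apply: leeD; apply: lee_wpmul2l; rewrite ?lee_fin.
  by rewrite -!EFinM -EFinD lee_fin -mulrDl addrC subrK mul1r.
(* A violation at [g] and [j] would make [chain_tail] bound 1 by the terms of [g] and [j] alone,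
   which are among the nonnegative summands of [f w < 1]. *)
move=> w /= fw1 g j; rewrite leNgt; apply/negP => bad.
have := chain_tail lam0 h0 rh bad; rewrite -/tau leNgt => /negP; apply.
apply: le_lt_trans fw1; rewrite /f; apply: lerD; apply: ler_wpM2l => //.
  by rewrite /f1 (bigD1 g)//= lerDl; apply: sumr_ge0 => *; exact: expR_ge0.
apply: ler_sum => k _.
by rewrite (bigD1 (j k))//= lerDl; apply: sumr_ge0 => *; exact: expR_ge0.
Qed.

End sample_mean.

Section Orlicz_mgf.
Context d (Z : measurableType d) (R : realType) (mu : probability Z R).
Variable W : Z -> R.
Hypothesis iW : mu.-integrable setT (EFin \o W).
Hypothesis W0 : \int[mu]_z (W z)%:E = 0.

(** Some admissible radius lies strictly below [B], and enlarging the radius lowers the integrand.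
    Strictness avoids asking whether the infimum is attained. *)
Lemma Orlicz_norm_lt (q B : R) : (0 < q)%R -> Orlicz_norm mu q W < B%:E ->
  (0 < B)%R /\ \int[mu]_z (expR (`|W z / B| `^ q) - 1)%:E <= 1.
Proof.
move=> q0 /ereal_inf_lt[_ [B' [B'0 EB'] <-]]; rewrite lte_fin => B'B.
have B0 := lt_trans B'0 B'B; split => //.
have mW : measurable_fun setT W by apply/measurable_EFinP; exact: measurable_int iW.
have mf C : measurable_fun setT (fun z => (expR (`|W z / C| `^ q) - 1)%:E).
  apply/measurable_EFinP; apply: measurable_funB => //.
  apply: measurableT_comp => //; apply: (measurableT_comp (measurable_powR q)).
  by apply: measurableT_comp => //; exact: measurable_funM.
have f0 C z : 0 <= (expR (`|W z / C| `^ q) - 1)%:E.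
  by rewrite lee_fin subr_ge0 -[leLHS]expR0 ler_expR powR_ge0.
apply: le_trans EB'; rewrite unlock; apply: ge0_le_integral => //.
move=> z _; rewrite lee_fin lerD2r ler_expR ge0_ler_powR ?nnegrE ?(ltW q0)//.
by rewrite !normrM ler_wpM2l// !gtr0_norm ?invr_gt0// lef_pV2 ?posrE// ltW.
Qed.

(** The rate applied to [W / B] is [1 / sqrt n <= 1] for [q = 1], as the subexponential bound
    requires, and [sqrt (u / n)] for [q = 2]. Both moments fit under one bound, whose n-th power is
    [expR (5 / 4 * u)]. *)
Lemma Orlicz_mgf (n : nat) (q B u : R) : (0 < n)%N -> q = 1%R \/ q = 2%R ->
  Orlicz_norm mu q W < B%:E -> (1 <= u)%R ->
  \int[mu]_z (expR (Num.sqrt n%:R * u `^ (1 - q^-1) / B / n%:R * W z))%:E <=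
  (expR (5 / 4 * u / n%:R))%:E.
Proof.
move=> n0 q12 /Orlicz_norm_lt; have q0 : (0 < q)%R by case: q12 => ->.
move=> /(_ q0)[B0 EW] u1.
have n0' : (0 < n%:R :> R)%R by rewrite ltr0n.
have sn0 : (0 < Num.sqrt n%:R :> R)%R by rewrite sqrtr_gt0.
have snE : (Num.sqrt n%:R ^+ 2 = n%:R :> R)%R by rewrite sqr_sqrtr// ler0n.
have sn1 : (1 <= Num.sqrt n%:R :> R)%R by rewrite -[leLHS]sqrtr1 ler_wsqrtr// ler1n.
have iX : mu.-integrable setT (EFin \o (fun z => W z / B)%R).
  rewrite (_ : _ \o _ = (fun z => (B^-1)%:E * (W z)%:E)); last first.
    by apply/funext => z; rewrite /= mulrC EFinM.
  exact: integrableZl.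
have X0 : \int[mu]_z (W z / B)%:E = 0.
  under eq_integral do rewrite mulrC EFinM.
  by rewrite integralZl// W0 mule0.
have -> : (fun z => (expR (Num.sqrt n%:R * u `^ (1 - q^-1) / B / n%:R * W z))%:E) =
   (fun z => (expR (u `^ (1 - q^-1) / Num.sqrt n%:R * (W z / B)))%:E).
  apply/funext => z; congr (expR _)%:E.
  set sn := Num.sqrt n%:R in sn0 snE *; rewrite -[in LHS]snE; field.
  by rewrite !gt_eqF.
case: q12 EW => -> EW.
  rewrite invr1 subrr powRr0 div1r.
  apply: le_trans (mgf_subexponential iX X0 _ _ _) _.
  - by rewrite invr_ge0 ltW.
  - by rewrite invf_le1.
  - by apply: le_trans EW; under [leRHS]eq_integral do rewrite powRr1//.
  rewrite lee_fin ler_expR exprVn snE -[leLHS]mul1r ler_wpM2r ?invr_ge0 ?ltW//; lra.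
rewrite (_ : 1 - 2^-1 = 2^-1 :> R)%R; last by field.
rewrite powR12_sqrt; last by lra.
apply: le_trans (mgf_subgaussian iX X0 _ _) _.
- by rewrite divr_ge0 ?sqrtr_ge0.
- apply: le_trans EW.
  under [leRHS]eq_integral do rewrite powR_mulrn// real_normK ?num_real//.
  by [].
by rewrite lee_fin ler_expR expr_div_n snE sqr_sqrtr ?mulrA//; lra.
Qed.

End Orlicz_mgf.

(** * Chaining *)

Section sample_mean_algebra.
Context (R : realType) (Z : Type) (n : nat).
Implicit Types (f g : Z -> R) (d : n.-tuple Z).
Local Open Scope ring_scope.

Lemma sample_mean_cst (a : R) d : (0 < n)%N -> sample_mean (cst a) d = a.
Proof.
move=> n0; rewrite /sample_mean/= sumr_const card_ord -[X in _ * X]mulr_natl mulKf//.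
by rewrite pnatr_eq0 -lt0n.
Qed.

Lemma sample_meanB f g d :
  sample_mean (fun z => f z - g z) d = sample_mean f d - sample_mean g d.
Proof. by rewrite /sample_mean sumrB mulrBr. Qed.

Lemma sample_meanZ f (a : R) d :
  sample_mean (fun z => a * f z) d = a * sample_mean f d.
Proof. by rewrite /sample_mean -mulr_sumr mulrCA. Qed.

Lemma ler_sample_mean f g d :
  (forall i, f (tnth d i) <= g (tnth d i)) -> sample_mean f d <= sample_mean g d.
Proof. by move=> fg; rewrite ler_wpM2l ?invr_ge0// ler_sum. Qed.

End sample_mean_algebra.

Section chaining.
Context d (T : measurableType d) d' (Z : measurableType d') (R : realType).
Variables (P : probability T R) (mu : probability Z R) (n : nat).
Hypothesis n0 : (0 < n)%N.
Variable D : T -> n.-tuple Z.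
Hypothesis hD : iid_sample P mu D.
Variables (Th : Type) (L : Th -> Z -> R) (rk : Th -> R) (Q : set Th) (fs : Th).
Hypothesis mL : forall f, Q f \/ f = fs -> measurable_fun setT (L f).
Hypothesis L0 : forall f z, (0 <= L f z)%R.
Hypothesis intL : forall f, Q f \/ f = fs -> \int[mu]_z (L f z)%:E = (rk f)%:E.
Variable psi : Th -> Th -> R.
Hypothesis hpsi : metric_on Q psi.
Variable G : Z -> R.
Hypothesis mG : measurable_fun setT G.
Hypothesis G0 : forall z, (0 <= G z)%R.
Variables (r theta : R).
Hypothesis r0 : (0 <= r)%R.
Hypothesis r1 : (r <= 1)%R.
Hypothesis theta0 : (0 < theta)%R.
Hypothesis C5 : forall f, Q f ->
  \int[mu]_z (expR (theta^-1 * (r * (rk f - rk fs) - (L f z - L fs z))))%:E <= 1.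

Definition lipschitz_at (z : Z) :=
  forall f g, Q f -> Q g -> (L f z - L g z <= G z * psi f g)%R.

Hypothesis lip : {ae mu, forall z, lipschitz_at z}.

Lemma lipschitz_risk (f g : Th) : Q f -> Q g ->
  (rk f - rk g)%:E <= (psi f g)%:E * \int[mu]_z (G z)%:E.
Proof.
move=> Qf Qg; have [p0 _ _ _] := hpsi; have pfg := p0 f g Qf Qg.
(* With [rk g] on the right all integrands are nonnegative, and the expectation of [G] may be
   infinite. *)
rewrite EFinB leeBlDl// -!intL; [|by left..].
have mLf h : Q h -> measurable_fun setT (fun z => (L h z)%:E).
  by move=> Qh; apply/measurable_EFinP; apply: mL; left.
have mG' : measurable_fun setT (fun z => (G z)%:E) by exact/measurable_EFinP.
rewrite -ge0_integralZl//; last by move=> z _; rewrite lee_fin.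
rewrite -ge0_integralD//; last 4 first.
- by move=> z _; rewrite lee_fin.
- exact: mLf.
- by move=> z _; rewrite -EFinM lee_fin mulr_ge0.
- exact: measurable_funeM.
apply: ae_ge0_le_integral => //.
- by move=> z _; rewrite lee_fin.
- exact: mLf.
- by move=> z _; rewrite -EFinM -EFinD lee_fin addr_ge0// mulr_ge0.
- by apply: emeasurable_funD; [exact: mLf|exact: measurable_funeM].
apply: filterS lip => z lz _; rewrite -EFinM -EFinD lee_fin.
by have := lz f g Qf Qg; lra.
Qed.

(** By the product formula all observations avoid the null set almost surely, so this event costs no
    probability. *)
Lemma with_prob_ge_lipschitz :
  with_prob_ge P 1 [set w | forall i, lipschitz_at (tnth (D w) i)].
Proof.
have [N [mN N0 hN]] := lip.
exists [set w | forall i, (~` N) (tnth (D w) i)]; split.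
- exact: (iid_measurable_all hD (fun=> measurableC mN)).
- rewrite (proj2 hD (fun _ => ~` N)); last by move=> i; exact: measurableC.
  rewrite big1// => i _; rewrite [LHS](probability_setC mu mN) N0.
  by rewrite sube0.
- by move=> w Nw i; have := Nw i; apply: contra_notP; exact: hN.
Qed.

(* [c k 0, ..., c k (N k - 1)] is the net at scale [dk k]; [eta] is the error
   allowed in the minimality of the points of the coarsest net. *)
Lemma chain_bound (K : nat) (N : nat -> nat) (c : nat -> nat -> Th)
    (dk rho h M : nat -> R) (a eta p : R) :
  (forall k i, (k <= K)%N -> (i < N k)%N -> Q (c k i)) ->
  (forall f, Q f -> exists i, [/\ (i < N 0%N)%N, (psi f (c 0%N i) <= dk 0%N)%R &
      (rk (c 0%N i) - eta <= rk f)%R]) ->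
  (forall k f, (k <= K)%N -> Q f ->
      exists i, (i < N k)%N /\ (psi f (c k i) <= dk k)%R) ->
  (forall k, (k < K)%N -> (0 < h k)%R /\ (3 <= rho k * h k)%R) ->
  (forall k, (k < K)%N -> (1 <= M k)%R) ->
  (forall k f g, (k < K)%N -> Q f -> Q g -> (psi f g <= dk k.+1 + dk k)%R ->
    \int[mu]_z (expR (rho k / n%:R * ((rk f - rk g) - (L f z - L g z))))%:E
      <= (M k)%:E) ->
  (0 <= eta)%R ->
  ((N 0%N)%:R * expR (- (n%:R / theta * a)) <= p)%R ->
  (\sum_(k < K) (N k.+1 * N k)%:R * (expR (- (rho k * h k)) * M k ^+ n) <= p)%R ->
  with_prob_ge P (1 - p)
    [set w | (forall i, lipschitz_at (tnth (D w) i)) ->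
      forall t, (0 <= t)%R -> \int[mu]_z (G z)%:E + (sample_mean G (D w))%:E <= t%:E ->
      forall f, Q f -> (r * (rk f - rk fs) <= a + 4 / 3 * (\sum_(k < K) h k) +
        (sample_mean (L f) (D w) - sample_mean (L fs) (D w)) + dk K * t + eta)%R].
Proof.
move=> Qc net0 net h_rho M1 EU eta0 Np Up.
have [psi_ge0 _ psi_sym psi_tri] := hpsi.
have mLQ f : Q f -> measurable_fun setT (L f) by move=> Qf; apply: mL; left.
have mLs : measurable_fun setT (L fs) by apply: mL; right.
pose A (i : 'I_(N 0%N)) z :=
  (r * (rk (c 0%N i) - rk fs) - (L (c 0%N i) z - L fs z))%R.
pose J (k : 'I_K) := ('I_(N k.+1) * 'I_(N k))%type : finType.
pose W (k : nat) i j z :=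
  ((rk (c k.+1 i) - rk (c k j)) - (L (c k.+1 i) z - L (c k j) z))%R.
(* A link between distant points is replaced by 0: no chain uses it and its moment is not
   controlled. The zero link has moment 1, at most [M k]. *)
pose U (k : 'I_K) (q : J k) : Z -> R :=
  if (psi (c k.+1 q.1) (c k q.2) <= dk k.+1 + dk k)%R then W k q.1 q.2 else cst 0%R.
have := @chain_deviation _ _ _ _ _ P mu n n0 D hD (N 0%N) K J A U theta a p
  (fun k => rho k) (fun k => h k) (fun k => M k) theta0.
case.
- move=> g; apply: measurable_funB; first exact: measurable_cst.
  by apply: measurable_funB => //; apply: mLQ; exact: Qc.
- by move=> g; apply: C5; exact: Qc.
- exact: Np.
- by move=> k; have [] := h_rho k (ltn_ord k).
- by move=> k; have [] := h_rho k (ltn_ord k).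
- move=> k q; rewrite /U; case: ifPn => _; last exact: measurable_cst.
  apply: measurable_funB; first exact: measurable_cst.
  apply: measurable_funB; apply: mLQ; apply: Qc => //; exact: ltnW.
- move=> k q; rewrite /U; case: ifPn => [psiq|_].
    by apply: EU => //; apply: Qc => //; exact: ltnW.
  under eq_integral do rewrite /= mulr0 expR0.
  rewrite integral_cst//= [X in _ * X]probability_setT mule1 lee_fin; exact: M1.
- apply: le_trans Up; apply: ler_sum => k _.
  by rewrite card_prod !card_ord.
move=> E [mE pE EE]; exists E; split => //.
move=> w /EE /= dev lw t t0 Gt f Qf.
have [i0 [i0N fi0 rki0]] := net0 f Qf.
(* Every level approximates [f] itself, not the point of the next level; at level 0 the near
   minimizer [i0] is imposed. *)
have /choice[iota hiota] : forall k, exists i, (k <= K)%N ->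
   [/\ (i < N k)%N, (psi f (c k i) <= dk k)%R & k = 0%N -> i = i0].
  case=> [|k]; first by exists i0.
  have [kK|_] := leqP k.+1 K; last by exists 0%N.
  by have [i [iN fi]] := net k.+1 f kK Qf; exists i.
have iN k : (k <= K)%N -> (iota k < N k)%N by move=> /hiota[].
have psik k : (k <= K)%N -> (psi f (c k (iota k)) <= dk k)%R by move=> /hiota[].
have iota0 : iota 0%N = i0 by have [_ _] := hiota 0%N (leq0n K); apply.
have Qk k : (k <= K)%N -> Q (c k (iota k)) by move=> kK; apply: Qc => //; exact: iN.
pose q (k : 'I_K) : J k :=
  (Ordinal (iN k.+1 (ltn_ord k)), Ordinal (iN k (ltnW (ltn_ord k)))).
pose dv g := (rk g - sample_mean (L g) (D w))%R.
have Uq (k : 'I_K) : sample_mean (U k (q k)) (D w) =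
    (dv (c k.+1 (iota k.+1)) - dv (c k (iota k)))%R.
  have kK := ltn_ord k.
  have -> : U k (q k) = W k (iota k.+1) (iota k).
    rewrite /U /= ifT//.
    apply: (@le_trans _ _ (psi (c k.+1 (iota k.+1)) f + psi f (c k (iota k)))%R).
      by apply: psi_tri => //; apply: Qk => //; exact: ltnW.
    rewrite psi_sym//; last exact: Qk.
    by apply: lerD; apply: psik => //; exact: ltnW.
  rewrite /W sample_meanB (sample_mean_cst _ _ n0) sample_meanB /dv; ring.
have telescope : (\sum_k sample_mean (U k (q k)) (D w) =
    dv (c K (iota K)) - dv (c 0%N i0))%R.
  rewrite -iota0; under eq_bigr do rewrite Uq.
  rewrite -(big_mkord xpredT (fun k => dv (c k.+1 (iota k.+1)) - dv (c k (iota k)))%R).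
  by rewrite telescope_sumr.
have := dev (Ordinal i0N) q; rewrite telescope.
rewrite /A sample_meanB (sample_mean_cst _ _ n0) sample_meanB/=.
(* (C3) is used twice, for the risks and, with the arguments exchanged, for the empirical means;
   hence the sum of the two means of [G]. *)
have last_link : (dv f - dv (c K (iota K)) <= dk K * t)%R.
  have QK := Qk K (leqnn K).
  have pf0 := psi_ge0 _ _ Qf QK.
  have G0' : (0 <= sample_mean G (D w))%R.
    by rewrite mulr_ge0 ?invr_ge0//; apply: sumr_ge0.
  have EGfin : \int[mu]_z (G z)%:E \is a fin_num.
    rewrite ge0_fin_numE; last by apply: integral_ge0 => z _; rewrite lee_fin.
    apply: le_lt_trans (ltry t); apply: le_trans Gt.
    by rewrite leeDl// lee_fin.
  have := lipschitz_risk Qf QK.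
  rewrite -(fineK EGfin) -EFinM lee_fin => Ef.
  have Gt' : (fine (\int[mu]_z (G z)%:E) + sample_mean G (D w) <= t)%R.
    by move: Gt; rewrite -{1}(fineK EGfin) -EFinD lee_fin.
  have mean_le : (sample_mean (L (c K (iota K))) (D w) - sample_mean (L f) (D w)
      <= psi f (c K (iota K)) * sample_mean G (D w))%R.
    rewrite -sample_meanB -sample_meanZ; apply: ler_sample_mean => i.
    by rewrite [leRHS]mulrC (psi_sym f)//; exact: lw.
  apply: (@le_trans _ _ (psi f (c K (iota K)) * t)%R).
    apply: (@le_trans _ _ (psi f (c K (iota K)) *
      (fine (\int[mu]_z (G z)%:E) + sample_mean G (D w)))%R).
      by rewrite mulrDr /dv; lra.
    by rewrite ler_wpM2l.
  by rewrite ler_wpM2r// psik.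
move: last_link rki0; rewrite /dv.
set x := (rk f - rk (c 0%N i0))%R.
(* [x] may be negative, where [r * x <= x] can fail; near minimality of the net point makes
   [x + eta] nonnegative, and then [r <= 1] suffices. *)
have : (0 <= x + eta)%R -> (r * x <= x + eta)%R.
  have : (0 <= r * eta)%R by rewrite mulr_ge0.
  by move=> ? /(mulr_ge0 (_ : 0 <= 1 - r)%R); rewrite subr_ge0 r1 => /(_ isT); lra.
rewrite /x; lra.
Qed.

End chaining.

(** * Entropy *)

Section entropy.
Context (R : realType) (T : Type).
Implicit Types (psi : T -> T -> R) (e : R) (F : set T).

Lemma entropy_ge0 psi e F : 0 <= entropy psi e F.
Proof. by rewrite /entropy lne_ge0 le_max lexx. Qed.

Lemma entropy_nonincreasing psi e e' F : (e <= e')%R ->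
  entropy psi e' F <= entropy psi e F.
Proof.
move=> ee'; rewrite /entropy.
have max0 (x : \bar R) : maxe 1 x \in `[0, +oo].
  by rewrite in_itv/= leey andbT le_max lee01.
rewrite lee_lne//; rewrite ge_max; apply/andP; split; first by rewrite le_max lexx.
rewrite le_max; apply/orP; right.
apply: le_ereal_inf => _ [k [c [Fc cF]] <-]; exists k => //; exists c; split => // f Ff.
by have [i fi] := cF f Ff; exists i; exact: le_trans ee'.
Qed.

(** The covering number is an infimum of natural numbers, hence attained once the entropy is
    finite. *)
Lemma entropy_net psi e F (x0 : T) : entropy psi e F < +oo ->
  exists (N : nat) (c : nat -> T),
    [/\ forall i, (i < N)%N -> F (c i),
        forall f, F f -> exists i, (i < N)%N /\ (psi f (c i) <= e)%R &
        (N%:R <= expR (fine (entropy psi e F)))%R].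
Proof.
rewrite /entropy /covering_number; set S := [set k : nat | _].
have [[k0 Sk0]|S0] := pselect (exists k, S k); last first.
  rewrite (_ : [set _ | k in S] = set0); last first.
    by apply/seteqP; split => // x [k Sk _]; apply: S0; exists k.
  by rewrite ereal_inf0 (max_idPr _) ?leey// ltxx.
have ex : exists k, `[< S k >] by exists k0; exact/asboolP.
case: (ex_minnP ex) => N /asboolP SN minN _.
have -> : ereal_inf [set k%:R%:E | k in S] = N%:R%:E :> \bar R.
  apply/eqP; rewrite eq_le; apply/andP; split.
    by apply: ereal_inf_lbound; exists N.
  apply: le_ereal_inf_tmp => _ [k Sk <-]; rewrite lee_fin ler_nat.
  by apply: minN; exact/asboolP.
case: SN => c [Fc cF].
(* Padding by [x0] gives nets of all sizes the same type, so that they can be chosen as a function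
   of the level. *)
exists N, (fun i => if insub i is Some o then c o else x0); split.
- by move=> i iN; rewrite insubT.
- move=> f Ff; have [i fi] := cF f Ff; exists i; split => //.
  by rewrite insubT//= => ?; rewrite (_ : Sub _ _ = i)//; exact: val_inj.
- rewrite -EFin_max lne_EFin/= ?lt_max ?ltr01// lnK ?posrE ?lt_max ?ltr01//.
  by rewrite le_max lexx orbT.
Qed.

End entropy.

(** * Dyadic lower bounds for integrals *)

Section lower_integral.
Context d (T : measurableType d) (R : realType).
Variable mu : {measure set T -> \bar R}.

(* For a possibly nonmeasurable f the library integral is a lower integral. *)
Lemma ge0_le_lower_integral (f g : T -> \bar R) : (forall x, 0 <= f x) ->
  (forall x, f x <= g x) -> \int[mu]_x f x <= \int[mu]_x g x.
Proof.
move=> f0 fg; have g0 x : 0 <= g x by exact: le_trans (fg x).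
rewrite !ge0_integralTE//; apply: le_ereal_sup => _ [h hf <-]; exists h => // x.
exact: le_trans (fg x).
Qed.

End lower_integral.

Lemma ler_half_pow (R : realType) (e : R) (j k : nat) : (0 < e)%R -> (j <= k)%N ->
  (e / 2 ^+ k <= e / 2 ^+ j)%R.
Proof.
by move=> e0 jk; rewrite ler_pM2l// lef_pV2 ?posrE ?exprn_gt0// ler_weXn2l// ler1n.
Qed.

(** On []e / 2 ^+ k.+2, e / 2 ^+ k.+1]], of length [e / 2 ^+ k.+2], the nonincreasing [v] is at
    least its value at the right end. The [K] pieces are disjoint and lie above [e / 2 ^+ K.+1],
    hence above [delta]. *)
Lemma dyadic_integral_ge (R : realType) (v : R -> \bar R) (e delta : R) (K : nat) :
  (0 < e)%R -> (delta <= e / 2 ^+ K.+1)%R ->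
  (forall z, 0 <= v z) ->
  (forall y z, (0 < y)%R -> (y <= z)%R -> (z <= e)%R -> v z <= v y) ->
  \sum_(k < K) v (e / 2 ^+ k.+1)%R * (e / 2 ^+ k.+2)%:E <=
  \int[lebesgue_measure]_(z in `[delta, e]) v z.
Proof.
move=> e0 de v0 vmono.
pose I (k : nat) := `]e / 2 ^+ k.+2, e / 2 ^+ k.+1]%classic%R : set R.
have mI k : measurable (I k) by exact: measurable_itv.
pose s (k : 'I_K) := cst (v (e / 2 ^+ k.+1)%R) \_ (I k).
have s0 k z : 0 <= s k z by rewrite /s; apply: erestrict_ge0 => *; exact: v0.
have ms k : measurable_fun setT (s k).
  apply: (measurable_restrictT _ _).1 => //.
have -> : \sum_(k < K) v (e / 2 ^+ k.+1)%R * (e / 2 ^+ k.+2)%:E =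
   \int[lebesgue_measure]_z (\sum_k s k z).
  rewrite ge0_integral_sum//; apply: eq_bigr => k _.
  have muI : lebesgue_measure (I k) = (e / 2 ^+ k.+2)%:E.
    rewrite /I lebesgue_measure_itv/= lte_fin ifT.
      by rewrite -EFinB; congr EFin; rewrite (exprS _ k.+1); field; rewrite expf_neq0.
    by rewrite ltr_pM2l// ltf_pV2 ?posrE ?exprn_gt0// ltr_eXn2l// ltr1n.
  rewrite /s -integral_mkcond integral_cst; [by rewrite -muI|exact: mI].
rewrite [leRHS]integral_mkcond; apply: ge0_le_lower_integral => [z|z].
  by apply: sume_ge0 => k _; exact: s0.
have [[k Ikz]|nI] := pselect (exists k : 'I_K, I k z); last first.
  rewrite big1; first by apply: erestrict_ge0 => *; exact: v0.
  by move=> k _; rewrite /s patchE memNset// => Ikz; apply: nI; exists k.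
have disj (i j : nat) : (i < j)%N -> I i z -> I j z -> False.
  move=> ij; rewrite /I/= !in_itv/= => /andP[iz _] /andP[_ jz].
  by have := lt_le_trans iz jz; rewrite ltNge ler_half_pow.
rewrite (bigD1 k)//= [X in _ + X]big1 ?adde0; last first.
  move=> j jk; rewrite /s patchE memNset// => Ijz.
  case: (ltngtP j k) jk => [jk|kj|/val_inj ->]; last by rewrite eqxx.
  - by move=> _; exact: disj jk Ijz Ikz.
  - by move=> _; exact: disj kj Ikz Ijz.
rewrite /s !patchE mem_set//; move: Ikz; rewrite /I/= in_itv/= => /andP[z1 z2].
have z0 : (0 < z)%R by apply: le_lt_trans z1; apply: divr_ge0; [exact: ltW|exact: exprn_ge0].
have ke : (e / 2 ^+ k.+1 <= e)%R.
  by rewrite ler_pdivrMr ?exprn_gt0// ler_peMr ?(ltW e0)// exprn_ege1// ler1n.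
rewrite mem_set/=; first exact: vmono.
rewrite in_itv/=; apply/andP; split; last exact: le_trans z2 ke.
apply: le_trans de _; apply: le_trans (ltW z1); apply: ler_half_pow => //.
by rewrite ltnS; exact: ltn_ord.
Qed.

Lemma exists_half_pow_lt (R : realType) (e x : R) : (0 < x)%R ->
  exists m, (e / 2 ^+ m < x)%R.
Proof.
move=> x0; have := @archi_boundP R (`|e| / x) _.
rewrite divr_ge0 ?(ltW x0)// => /(_ isT); set m := Num.bound _ => hm.
exists m; rewrite ltr_pdivrMr ?exprn_gt0//.
move: hm; rewrite ltr_pdivrMr// => hm; apply: le_lt_trans (ler_norm e) _.
apply: lt_trans hm _; rewrite mulrC ltr_pM2l// -natrX ltr_nat.
exact: ltn_expl.
Qed.

(** * Nets and links at dyadic scales *)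

Section multiscale.
Context d (T : measurableType d) d' (Z : measurableType d') (R : realType).
Variables (P : probability T R) (mu : probability Z R) (n : nat).
Hypothesis n0 : (0 < n)%N.
Variable D : T -> n.-tuple Z.
Hypothesis hD : iid_sample P mu D.
Variables (Th : Type) (L : Th -> Z -> R) (rk : Th -> R) (Q : set Th) (fs : Th).
Hypothesis mL : forall f, Q f \/ f = fs -> measurable_fun setT (L f).
Hypothesis L0 : forall f z, (0 <= L f z)%R.
Hypothesis intL : forall f, Q f \/ f = fs -> \int[mu]_z (L f z)%:E = (rk f)%:E.
Variable psi : Th -> Th -> R.
Hypothesis hpsi : metric_on Q psi.

Lemma integrable_loss f : Q f \/ f = fs -> mu.-integrable setT (EFin \o L f).
Proof.
move=> Qf; apply/integrableP; split; first by apply/measurable_EFinP; exact: mL.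
apply: le_lt_trans (ltry (rk f)); rewrite -intL// le_eqVlt; apply/orP; left.
by apply/eqP; apply: eq_integral => z _; rewrite /= ger0_norm.
Qed.

Lemma integrable_loss_diff f g : Q f \/ f = fs -> Q g \/ g = fs ->
  mu.-integrable setT (EFin \o (fun z => L f z - L g z)%R).
Proof.
move=> Qf Qg; rewrite (_ : _ \o _ = (EFin \o L f) \- (EFin \o L g)).
  by apply: integrableB => //; exact: integrable_loss.
by apply/funext => z; rewrite /= EFinB.
Qed.

Lemma integral_loss_diff f g : Q f \/ f = fs -> Q g \/ g = fs ->
  \int[mu]_z (L f z - L g z)%:E = (rk f - rk g)%:E.
Proof.
move=> Qf Qg; under eq_integral do rewrite EFinB.
rewrite integralB//; [|exact: integrable_loss|exact: integrable_loss].
by rewrite !intL.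
Qed.

(** In each cell the centre is exchanged for a point whose risk is within [eta] of the infimum over
    the cell; the triangle inequality through the centre doubles the radius. An empty cell keeps its
    centre. *)
Lemma near_minimizing_net (e eta : R) : (0 < eta)%R -> entropy psi e Q < +oo ->
  exists (N : nat) (c : nat -> Th),
    [/\ forall i, (i < N)%N -> Q (c i),
        forall f, Q f -> exists i, [/\ (i < N)%N, (psi f (c i) <= 2 * e)%R &
          (rk (c i) - eta <= rk f)%R] &
        (N%:R <= expR (fine (entropy psi e Q)))%R].
Proof.
have [psi_ge0 psi_eq0 psi_sym psi_tri] := hpsi.
move=> eta0 /(entropy_net fs)[N [c [Qc cov hN]]].
have /choice[g hg] : forall i, exists g, (i < N)%N -> [/\ Q g,
    (exists2 f, Q f & psi f (c i) <= e)%R -> (psi g (c i) <= e)%R &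
    forall f, Q f -> (psi f (c i) <= e)%R -> (rk g - eta <= rk f)%R].
  move=> i; have [iN|_] := ltnP i N; last by exists fs.
  pose V := [set rk f | f in [set f | Q f /\ (psi f (c i) <= e)%R]].
  have [[f0 [Qf0 f0i]]|nV] := pselect (exists f, Q f /\ (psi f (c i) <= e)%R); last first.
    exists (c i); split; first exact: Qc.
      by case=> f Qf fi; exfalso; apply: nV; exists f.
    by move=> f Qf fi; exfalso; apply: nV; exists f.
  have hV : has_inf V.
    split; first by exists (rk f0), f0.
    exists 0%R => _ [f [Qf _] <-]; rewrite -lee_fin -intL; last by left.
    by apply: integral_ge0 => z _; rewrite lee_fin.
  have [_ [f [Qf fi] <-] fV] := inf_adherent eta0 hV.
  exists f => _; split => // f' Qf' f'i.
  rewrite lerBlDr; apply: (le_trans (ltW fV)); rewrite lerD2r.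
  by apply: ge_inf; [exact: hV.2|exists f'].
exists N, g; split => //.
- by move=> i /hg[].
- move=> f Qf; have [i [iN fi]] := cov f Qf; exists i.
  have [Qg ge gm] := hg i iN; split => //; last exact: gm.
  have := psi_tri f (c i) (g i) Qf (Qc i iN) Qg.
  rewrite (psi_sym (c i))//; last exact: Qc.
  have : (psi (g i) (c i) <= e)%R by apply: ge; exists f.
  lra.
Qed.

Lemma ln_ge3 (x : R) : (32 <= x)%R -> (3 <= ln x)%R.
Proof.
move=> x32; rewrite -[leLHS]expRK ler_ln ?posrE ?expR_gt0//; last by lra.
apply: le_trans x32.
have -> : (expR 3 = expR 1 ^+ 3 :> R)%R by rewrite -expRM_natl mulr1.
have e3 := @expR1_le3 R; have e0 := @expR_ge0 R 1.
by apply: (@le_trans _ _ (3 ^+ 3)%R); [rewrite lerXn2r ?nnegrE|lra].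
Qed.

Lemma sum_half_pow_le1 (K : nat) : (\sum_(k < K) (2 ^+ k.+1)^-1 <= 1 :> R)%R.
Proof.
suff -> : (\sum_(k < K) (2 ^+ k.+1)^-1 = 1 - (2 ^+ K)^-1 :> R)%R.
  by rewrite gerBl invr_ge0 exprn_ge0.
elim: K => [|K IH]; first by rewrite big_ord0 expr0 invr1 subrr.
by rewrite big_ord_recr/= IH exprS; field; rewrite expf_neq0.
Qed.

Variable G : Z -> R.
Hypothesis mG : measurable_fun setT G.
Hypothesis G0 : forall z, (0 <= G z)%R.
Variables (r theta : R).
Hypothesis r0 : (0 <= r)%R.
Hypothesis r1 : (r <= 1)%R.
Hypothesis theta0 : (0 < theta)%R.
Hypothesis C5 : forall f, Q f ->
  \int[mu]_z (expR (theta^-1 * (r * (rk f - rk fs) - (L f z - L fs z))))%:E <= 1.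
Hypothesis lip : {ae mu, forall z, lipschitz_at L Q psi G z}.

(* The coarsest scale is doubled since the near minimizer of a cell replaces its
   centre. *)
Definition net_scale (e : R) (k : nat) : R :=
  if k == 0%N then (2 * e)%R else (e / 2 ^+ k)%R.

(** This is [chain_bound] at the scales [e / 2 ^+ k]. The Orlicz condition is asked only when
    [0 < K], that is when there are links, so that [K = 0] serves the case without (C4). *)
Lemma multiscale_bound (K : nat) (e eta gamma S q : R) :
  (0 < eta)%R -> (0 < gamma)%R -> (gamma < 1)%R ->
  (forall k, (k <= K)%N -> entropy psi (e / 2 ^+ k)%R Q < +oo) ->
  q = 1%R \/ q = 2%R ->
  ((0 < K)%N -> [/\ (0 < e)%R, (0 < S)%R & forall f g, Q f -> Q g ->
     Orlicz_norm mu q (fun z => (rk f - rk g) - (L f z - L g z))%R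
       <= (S * psi f g)%:E]) ->
  let v z := (2 * fine (entropy psi z Q) + ln (32 * e / (z * gamma)))%R in
  with_prob_ge P (1 - gamma / 4)
    [set w | (forall i, lipschitz_at L Q psi G (tnth (D w) i)) ->
      forall t, (0 <= t)%R -> \int[mu]_z (G z)%:E + (sample_mean G (D w))%:E <= t%:E ->
      forall f, Q f -> (r * (rk f - rk fs) <=
        theta * ((fine (entropy psi e Q) + ln (4 / gamma)) / n%:R) +
        \sum_(k < K) 32 * S / Num.sqrt n%:R *
          (v (e / 2 ^+ k.+1) `^ q^-1 * (e / 2 ^+ k.+2)) +
        (sample_mean (L f) (D w) - sample_mean (L fs) (D w)) +
        net_scale e K * t + eta)%R].
Proof.
move=> eta0 gam0 gam1 Hfin q12 C4 v.
have q0 : (0 < q)%R by case: q12 => ->.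
have n0' : (0 < n%:R :> R)%R by rewrite ltr0n.
have sn0 : (0 < Num.sqrt n%:R :> R)%R by rewrite sqrtr_gt0.
have [psi_ge0 _ psi_sym psi_tri] := hpsi.
have p2 k : (0 < 2 ^+ k :> R)%R by rewrite exprn_gt0.
have /choice[Nc hNc] : forall k, exists Nc : nat * (nat -> Th), (k <= K)%N ->
    [/\ forall i, (i < Nc.1)%N -> Q (Nc.2 i),
        (Nc.1%:R <= expR (fine (entropy psi (e / 2 ^+ k)%R Q)))%R &
        forall f, Q f -> exists i, [/\ (i < Nc.1)%N,
           (psi f (Nc.2 i) <= net_scale e k)%R &
           k = 0%N -> (rk (Nc.2 i) - eta <= rk f)%R]].
  case=> [|k].
    have := Hfin 0%N (leq0n K); rewrite expr0 divr1 => /(near_minimizing_net eta0).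
    move=> [N [c [Qc cov hN]]]; exists (N, c) => _; split => // f Qf.
    by have [i [iN fi ri]] := cov f Qf; exists i.
  have [kK|_] := leqP k.+1 K; last by exists (0%N, fun=> fs).
  have [N [c [Qc cov hN]]] := entropy_net fs (Hfin k.+1 kK).
  exists (N, c) => _; split => // f Qf.
  by have [i [iN fi]] := cov f Qf; exists i.
pose N k := (Nc k).1; pose c k := (Nc k).2.
(* Links from level k+1 to level k have length at most [5 * (e / 2 ^+ k.+1)],
   hence Orlicz norm less than [B k]; [h k = 9 / 4 * B k * vk k `^ q^-1 / sqrt n],
   and [4 / 3 * 12 = 16] is half of the constant 32 because [e / 2 ^+ k.+1] is
   twice the length of the piece of the integral that pays for [h k]. *)
pose B k := (16 / 3 * S * (e / 2 ^+ k.+1))%R.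
pose vk k := v (e / 2 ^+ k.+1)%R.
pose h k := (12 * S * (e / 2 ^+ k.+1) * vk k `^ q^-1 / Num.sqrt n%:R)%R.
pose rho k := (Num.sqrt n%:R * vk k `^ (1 - q^-1) / B k)%R.
pose M k := expR (5 / 4 * vk k / n%:R).
have fH0 z : (0 <= fine (entropy psi z Q))%R by apply: fine_ge0; exact: entropy_ge0.
have lnE k : (0 < e)%R -> (32 * e / (e / 2 ^+ k.+1 * gamma) = 32 * 2 ^+ k.+1 / gamma)%R.
  move=> e0; field.
  by rewrite !gt_eqF//.
have vk3 k : (0 < e)%R -> (3 <= vk k)%R.
  move=> e0; rewrite /vk /v lnE//.
  have : (3 <= ln (32 * 2 ^+ k.+1 / gamma))%R.
    apply: ln_ge3; rewrite ler_pdivlMr//.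
    apply: (@le_trans _ _ 32%R); first by rewrite ler_piMr// ltW.
    by rewrite ler_peMr// exprn_ege1// ler1n.
  by have := fH0 (e / 2 ^+ k.+1)%R; lra.
(* Since [M k ^+ n = expR (5 / 4 * vk k)], the factor 9/4 leaves [expR (- vk k)] for each pair of
   net points. *)
have rhoh k : (0 < e)%R -> (0 < S)%R -> (rho k * h k = 9 / 4 * vk k)%R.
  move=> e0 S0; have vpos : (0 < vk k)%R by have := vk3 k e0; lra.
  rewrite /rho /h /B.
  have : (vk k `^ (1 - q^-1) * vk k `^ q^-1 = vk k)%R.
    by rewrite -powRD ?subrK ?powRr1// ?(ltW vpos)// gt_eqF ?implybT.
  set y1 := (vk k `^ (1 - q^-1))%R; set y2 := (vk k `^ q^-1)%R => <-; field.
  by rewrite !gt_eqF//.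
have key := @chain_bound _ _ _ _ _ P mu n n0 D hD Th L rk Q fs mL L0 intL psi hpsi
  G mG G0 r theta r0 r1 theta0 C5 lip K N c (net_scale e) rho h M
  (theta * ((fine (entropy psi e Q) + ln (4 / gamma)) / n%:R))%R eta (gamma / 4).
apply: with_prob_geS (key _ _ _ _ _ _ _ _ _).
- move=> w hw lw t t0 Gt f Qf; have := hw lw t t0 Gt f Qf.
  rewrite (_ : (4 / 3 * \sum_(k < K) h k = \sum_(k < K) 32 * S / Num.sqrt n%:R *
          (v (e / 2 ^+ k.+1) `^ q^-1 * (e / 2 ^+ k.+2)))%R) ?addrA//.
  rewrite mulr_sumr; apply: eq_bigr => k _.
  rewrite /h -/(vk k) (exprS _ k.+1); field.
  by rewrite !gt_eqF.
- by move=> k i /hNc[+ _ _]; apply.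
- move=> f Qf; have [_ _ /(_ f Qf)[i [iN fi ri]]] := hNc 0%N (leq0n K).
  by exists i; split => //; exact: ri.
- move=> k f /hNc[_ _ cov] /cov[i [iN fi _]]; by exists i.
- move=> k kK; have [e0 S0 _] := C4 (leq_ltn_trans (leq0n k) kK).
  have vpos := vk3 k e0; split; last by rewrite rhoh//; lra.
  rewrite /h !mulr_gt0 ?invr_gt0// powR_gt0//; lra.
- move=> k kK; have [e0 S0 _] := C4 (leq_ltn_trans (leq0n k) kK).
  rewrite /M -[leLHS]expR0 ler_expR divr_ge0 ?(ltW n0')//.
  by have := vk3 k e0; lra.
- move=> k f g kK Qf Qg fg; have [e0 S0 hO] := C4 (leq_ltn_trans (leq0n k) kK).
  have vpos := vk3 k e0.
  have Qf' := or_introl (f = fs) Qf; have Qg' := or_introl (g = fs) Qg.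
  apply: Orlicz_mgf => //; last by lra.
  + rewrite (_ : _ \o _ = (fun _ => (rk f - rk g)%:E) \-
      (EFin \o (fun z => L f z - L g z)%R)).
      apply: integrableB => //; first exact: finite_measure_integrable_cst.
      exact: integrable_loss_diff.
    by apply/funext => z; rewrite /= EFinB.
  + under eq_integral do rewrite EFinB.
    rewrite integralB//.
    * rewrite integral_loss_diff// integral_cst// [X in _ * X - _]probability_setT mule1.
      by rewrite subee.
    * exact: finite_measure_integrable_cst.
    * exact: integrable_loss_diff.
  (* For [k = 0] the link has length at most [2 * e + e / 2], five times [e / 2]; for larger [k] the
     factor is 3. The excess of 16/3 over 5 gives the strict inequality. *)
  + apply: le_lt_trans (hO f g Qf Qg) _; rewrite lte_fin /B.
    have e20 : (0 < e / 2 ^+ k.+1)%R by rewrite divr_gt0.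
    have fg' : (psi f g <= 5 * (e / 2 ^+ k.+1))%R.
      apply: le_trans fg _; rewrite /net_scale/=.
      have ek : (e / 2 ^+ k = 2 * (e / 2 ^+ k.+1))%R.
        by rewrite exprS; field; rewrite gt_eqF.
      case: (k =P 0%N) => [k0|_]; last by rewrite ek; lra.
      by move: ek e20; rewrite k0 expr0 divr1; lra.
    rewrite -mulrA mulrCA ltr_pM2l//.
    apply: le_lt_trans fg' _; lra.
- exact: ltW.
(* The exponential of the chosen [a] is [gamma / 4] times [expR] of minus the entropy at [e], which
   offsets the size of the coarsest net. *)
- have [_ + _] := hNc 0%N (leq0n K); rewrite expr0 divr1 => N0H.
  have -> : (- (n%:R / theta * (theta * ((fine (entropy psi e Q) + ln (4 / gamma)) / n%:R)))
     = - fine (entropy psi e Q) - ln (4 / gamma))%R.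
    by field; rewrite !gt_eqF.
  rewrite expRD (expRN (ln _)) lnK ?posrE ?divr_gt0// invf_div mulrA ler_piMl//.
    by rewrite divr_ge0// ltW.
  by rewrite expRN ler_pdivrMr ?expR_gt0// mul1r.
(* Both nets of a link have at most [expR H] points, [H] being the entropy at the finer scale. The
   part [2 * H] of [vk k] cancels their product, and the logarithm leaves [gamma / 32] times a
   geometric weight. *)
- apply: (@le_trans _ _ (\sum_(k < K) gamma / 32 * (2 ^+ k.+1)^-1)%R); last first.
    rewrite -mulr_sumr; have := sum_half_pow_le1 K; nra.
  apply: ler_sum => k _; have kK := ltn_ord k.
  have [e0 S0 _] := C4 (leq_ltn_trans (leq0n k) kK).
  have [_ N1 _] := hNc k.+1 kK; have [_ N2 _] := hNc k (ltnW kK).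
  rewrite rhoh// /M -expRM_natl -expRD.
  have -> : (- (9 / 4 * vk k) + n%:R * (5 / 4 * vk k / n%:R) = - vk k)%R.
    by field; rewrite gt_eqF.
  set H := fine (entropy psi (e / 2 ^+ k.+1)%R Q) in N1.
  have N3 : ((Nc k).1%:R <= expR H)%R.
    apply: le_trans N2 _; rewrite ler_expR; apply: fine_le.
    - by rewrite ge0_fin_numE ?entropy_ge0// Hfin// ltnW.
    - by rewrite ge0_fin_numE ?entropy_ge0// Hfin.
    - by apply: entropy_nonincreasing; apply: ler_half_pow.
  have -> : expR (- vk k) = (expR H ^- 2 * (gamma / 32 / 2 ^+ k.+1))%R.
    rewrite /vk /v -/H lnE// opprD expRD !expRN expRM_natl lnK ?posrE ?divr_gt0 ?mulr_gt0//.
    by congr (_ * _)%R; field; rewrite !gt_eqF.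
  rewrite mulrA ler_piMl//.
    by rewrite !mulr_ge0 ?invr_ge0// ltW.
  rewrite ler_pdivrMr ?exprn_gt0 ?expR_gt0// mul1r expr2 natrM.
  by apply: ler_pM.
Qed.

End multiscale.

(** * Risks *)

Section excess_bound.
Context (R : realType) (T : Type) (psi : T -> T -> R) (F : set T) (n : nat).
Variables (gamma r0 Bs Tb r theta : R) (S : \bar R) (q eps delta : R).
Hypothesis r0' : (0 < r)%R.

Let net_term := theta%:E * ((entropy psi eps F + (ln (4 / gamma))%:E) * (n%:R^-1)%:E).

Let chain_term := 32%:E * S * ((Num.sqrt n%:R)^-1)%:E *
  \int[lebesgue_measure]_(z in `[delta, eps])
    (poweR (2%:E * entropy psi z F + (ln (32 * eps / (z * gamma)))%:E) q^-1).

Lemma excess_bound_ge (a i : \bar R) : a <= net_term -> i <= chain_term ->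
  (r^-1)%:E * (a + i + (8 * delta * Tb)%:E + Bs%:E) + (r0 / n%:R)%:E <=
  excess_bound psi F n gamma r0 Bs Tb r theta S q eps delta.
Proof.
move=> ha hi; rewrite /excess_bound leeD// lee_wpmul2l ?lee_fin ?invr_ge0 ?(ltW r0')//.
by do 2 (apply: leeD => //); exact: leeD.
Qed.

End excess_bound.

Section regression.
Context (R : realType) (X : ptopologicalType) (ell : R -> R -> R).
Hypothesis hell : forall y t, (0 <= ell y t)%R.
Hypothesis mell : measurable_fun setT (fun yt : R * R => ell yt.1 yt.2).
Variable mu : probability (obs X R) R.

Definition loss (f : X -> R) (z : obs X R) : R := ell z.2 (f z.1).

Lemma measurable_loss f : measurable_fun setT (f : borel X -> R) ->
  measurable_fun setT (loss f).
Proof.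
move=> mf.
have m2 : measurable_fun setT (fun z : obs X R => (z.2, f z.1)).
  apply: measurable_fun_pair; first exact: measurable_snd.
  by apply: (measurableT_comp mf); exact: measurable_fst.
exact: (measurableT_comp mell m2).
Qed.

Lemma riskE f : risk ell mu f = \int[mu]_z (loss f z)%:E.
Proof. by rewrite /risk unlock. Qed.

Lemma risk_ge0 f : 0 <= risk ell mu f.
Proof. by rewrite riskE; apply: integral_ge0 => z _; rewrite lee_fin; exact: hell. Qed.

Lemma excess_riskE Fs fs f : argmin_risk ell mu Fs fs ->
  excess_risk ell mu Fs f = risk ell mu f - risk ell mu fs.
Proof.
move=> [Ffs fsmin]; rewrite /excess_risk; congr (_ - _).
apply/eqP; rewrite eq_le; apply/andP; split; first by apply: ereal_inf_lbound; exists fs.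
by apply: le_ereal_inf_tmp => _ [g Fg <-]; exact: fsmin.
Qed.

(** The negative part of the difference is at most the loss of [g], so its integral is finite; the
    positive part plus the loss of [g] dominates the loss of [f], so its integral is infinite. *)
Lemma expectation_zdiff_pinfty f g : measurable_fun setT (loss f) ->
  measurable_fun setT (loss g) -> risk ell mu f = +oo -> risk ell mu g < +oo ->
  'E_mu[zdiff ell f g] = +oo.
Proof.
move=> mf mg rf rg; rewrite unlock integralE.
set h := fun z => (zdiff ell f g z)%:E.
have mh : measurable_fun setT h.
  by apply/measurable_EFinP; exact: measurable_funB.
have mf' : measurable_fun setT (fun z => (loss f z)%:E) by exact/measurable_EFinP.
have mg' : measurable_fun setT (fun z => (loss g z)%:E) by exact/measurable_EFinP.
have mp : measurable_fun setT h^\+ by exact: measurable_funepos.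
have mn : measurable_fun setT h^\- by exact: measurable_funeneg.
have l0 k z : 0 <= (loss k z)%:E by rewrite lee_fin; exact: hell.
have neg : \int[mu]_z h^\- z < +oo.
  apply: le_lt_trans rg; rewrite riskE; apply: ge0_le_integral => // z _.
  rewrite /h funenegE ge_max; apply/andP; split; last exact: l0.
  by rewrite -EFinN lee_fin /zdiff opprB lerBlDl lerDr; exact: hell.
have pos : \int[mu]_z h^\+ z = +oo.
  have : risk ell mu f <= \int[mu]_z h^\+ z + risk ell mu g.
    rewrite !riskE -ge0_integralD//; apply: ge0_le_integral => //.
    - exact: emeasurable_funD.
    move=> z _; rewrite -leeBlDr// -EFinB funeposE le_max; apply/orP; left.
    by [].
  rewrite rf leye_eq => /eqP.
  have := ge0_fin_numE (risk_ge0 g); rewrite rg => gfin.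
  by case: (\int[mu]_z h^\+ z) => [x| |]//; rewrite -(fineK gfin).
have nfin : \int[mu]_z h^\- z \is a fin_num.
  by rewrite ge0_fin_numE// integral_ge0.
by rewrite pos -(fineK nfin).
Qed.

End regression.

(** A point in infinitely many of the events for [eta = 1 / (m + 1)] satisfies the bound with
    arbitrarily small slack. *)
Lemma with_prob_ge_slack d (T : measurableType d) (R : realType)
    (P : probability T R) (p : R) (e : T -> \bar R) (b : \bar R) :
  (forall eta : R, (0 < eta)%R -> with_prob_ge P p [set w | e w <= b + eta%:E]) ->
  with_prob_ge P p [set w | e w <= b].
Proof.
move=> h.
have hm (m : nat) : with_prob_ge P p [set w | e w <= b + (m.+1%:R^-1)%:E].
  by apply: h; rewrite invr_gt0.
apply: with_prob_geS (with_prob_ge_lim_sup hm) => w hw /=.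
apply/lee_addgt0Pr => eta eta0.
have [m hm'] : exists m : nat, (m.+1%:R^-1 <= eta)%R.
  have [m me] := exists_half_pow_lt 1%R eta0.
  exists (2 ^ m)%N; apply: le_trans (ltW me).
  by rewrite div1r lef_pV2 ?posrE ?exprn_gt0// -natrX ler_nat.
have [j /= mj wj] := hw m I.
apply: le_trans wj _; rewrite leeD2l// lee_fin; apply: le_trans hm'.
by rewrite lef_pV2 ?posrE// ler_nat ltnS.
Qed.

(** * The empirical risk minimizer *)

Section erm.
Context (R : realType) (X : ptopologicalType) (ell : R -> R -> R).
Hypothesis hell : forall y t, (0 <= ell y t)%R.
Hypothesis mell : measurable_fun setT (fun yt : R * R => ell yt.1 yt.2).
Variables (mu : probability (obs X R) R) (Fs : set (X -> R)).
Hypothesis mFs : forall f, Fs f -> measurable_fun setT (f : borel X -> R).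
Variables (n : nat) (hn : (0 < n)%N).
Variables (dOmega : measure_display) (Omega : measurableType dOmega).
Variables (P : probability Omega R) (D : Omega -> n.-tuple (obs X R)).
Hypothesis hD : iid_sample P mu D.
Variables (Fn Fhat : n.-tuple (obs X R) -> set (X -> R)).
Variables (alpha : n.-tuple (obs X R) -> R) (beta : n.-tuple (obs X R) -> (X -> R) -> R).
Hypothesis hbeta : forall d f, Fn d f -> (0 <= beta d f)%R.
Variable fn : n.-tuple (obs X R) -> X -> R.
Hypothesis hfn : forall d, ERM ell (alpha d) (beta d) (Fn d) d (fn d).
Variable F : set (X -> R).
Hypothesis mF : forall f, F f -> measurable_fun setT (f : borel X -> R).
Variables (psi : (X -> R) -> (X -> R) -> R) (hpsi : metric_on F psi).
Variables (gamma : R) (hgamma0 : (0 < gamma)%R) (hgamma1 : (gamma < 1)%R).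
Variables (fs : X -> R) (hfs : argmin_risk ell mu Fs fs).
Variables (r0 : R) (hr0 : (0 <= r0)%R) (Fr0 : set (X -> R)).
Hypothesis hFr0 : Fr0 = large_excess ell mu Fs F (r0 / n%:R).
Hypothesis C1 : with_prob_ge P (1 - gamma / 4)
  [set w | Fhat (D w) `<=` Fn (D w) /\ Fn (D w) `<=` F].
Variables (Bs : R) (hBs : (0 <= Bs)%R).
Hypothesis C2 : with_prob_ge P (1 - gamma / 4)
  [set w | ereal_inf [set (emp_excess ell (D w) f fs + beta (D w) f)%:E
                     | f in Fhat (D w)]
           + (alpha (D w))%:E <= Bs%:E].
Variables (G : obs X R -> R) (hG : forall z, (0 <= G z)%R) (mG : measurable_fun setT G).
Variables (Tb : R) (hTb : (0 <= Tb)%R).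
Hypothesis C3ae : {ae mu, forall z : obs X R, forall f g, Fr0 f -> Fr0 g ->
  (zdiff ell f g z <= G z * psi f g)%R}.
Hypothesis C3T : with_prob_ge P (1 - gamma / 4)
  [set w | 'E_mu[G] + (n%:R^-1 * \sum_(i < n) G (tnth (D w) i))%:E <= Tb%:E].
Variables (r theta : R) (hrpos : (0 < r)%R) (hr1 : (r <= 1)%R) (htheta : (0 < theta)%R).
Hypothesis C5 : ereal_sup
  [set \int[mu]_z expeR ((r / theta)%:E * 'E_mu[zdiff ell f fs]
                         - (theta^-1 * zdiff ell f fs z)%:E)
  | f in Fr0] <= 1.

Hypothesis risk_fs_lty : risk ell mu fs < +oo.

Let rk f := fine (risk ell mu f).

Let Fr0F f : Fr0 f -> F f.
Proof. by rewrite hFr0 => -[]. Qed.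

Let mloss f : Fr0 f \/ f = fs -> measurable_fun setT (loss ell f).
Proof.
move=> [Qf|->]; apply: measurable_loss => //; first by apply: mF; exact: Fr0F.
by apply: mFs; case: hfs.
Qed.

(** An infinite risk would make the expectation in the exponent of (C5) infinite, and with it the
    exponential moment. *)
Lemma risk_lty f : Fr0 f -> risk ell mu f < +oo.
Proof.
move=> Qf; rewrite ltey; apply/negP => /eqP rf.
have : \int[mu]_z expeR ((r / theta)%:E * 'E_mu[zdiff ell f fs]
           - (theta^-1 * zdiff ell f fs z)%:E) <= 1.
  by apply: le_trans C5; apply: ereal_sup_ubound; exists f.
rewrite (expectation_zdiff_pinfty hell _ _ rf risk_fs_lty); last 2 first.
- by apply: mloss; left.
- by apply: mloss; right.
rewrite gt0_muley ?lte_fin ?divr_gt0//.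
under eq_integral do rewrite addye//=.
by rewrite integral_cst// [X in _ * X]probability_setT mule1.
Qed.

Let intL f : Fr0 f \/ f = fs -> \int[mu]_z (loss ell f z)%:E = (rk f)%:E.
Proof.
move=> Qf; rewrite -riskE fineK// ge0_fin_numE ?risk_ge0//.
by case: Qf => [/risk_lty|->].
Qed.

Let hpsiQ : metric_on Fr0 psi.
Proof.
have [p0 p1 p2 p3] := hpsi; split => *.
- by apply: p0; exact: Fr0F.
- by apply: p1; exact: Fr0F.
- by apply: p2; exact: Fr0F.
- by apply: p3; exact: Fr0F.
Qed.

Let Ezdiff f g : Fr0 f \/ f = fs -> Fr0 g \/ g = fs ->
  'E_mu[zdiff ell f g] = (rk f - rk g)%:E.
Proof.
move=> Qf Qg; rewrite unlock.
exact: (integral_loss_diff mloss (fun f z => hell _ _) intL Qf Qg).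
Qed.

Let C5' f : Fr0 f -> \int[mu]_z (expR (theta^-1 *
  (r * (rk f - rk fs) - (loss ell f z - loss ell fs z))))%:E <= 1.
Proof.
move=> Qf; apply: le_trans C5; apply: ereal_sup_ubound; exists f => //.
rewrite Ezdiff; [|by left|by right].
apply: eq_integral => z _; rewrite -EFinM -EFinB/=; congr (expR _)%:E.
rewrite /zdiff /loss; ring.
Qed.

(** The events of (C1), (C2), (C3) and [multiscale_bound] each miss at most [gamma / 4]. The bound
    is conditional on [Fr0], the class to which nets and (C3) to (C5) refer. *)
Lemma erm_event (K : nat) (e eta S q : R) : (0 < eta)%R ->
  (forall k, (k <= K)%N -> entropy psi (e / 2 ^+ k)%R Fr0 < +oo) ->
  q = 1%R \/ q = 2%R ->
  ((0 < K)%N -> [/\ (0 < e)%R, (0 < S)%R & forall f g, Fr0 f -> Fr0 g ->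
     Orlicz_norm mu q (fun z => fine 'E_mu[zdiff ell f g] - zdiff ell f g z)%R
       <= S%:E * (psi f g)%:E]) ->
  let v z := (2 * fine (entropy psi z Fr0) + ln (32 * e / (z * gamma)))%R in
  with_prob_ge P (1 - gamma)
    [set w | F (fn (D w)) /\
      (Fr0 (fn (D w)) -> (r * (rk (fn (D w)) - rk fs) <=
        theta * ((fine (entropy psi e Fr0) + ln (4 / gamma)) / n%:R) +
        \sum_(k < K) 32 * S / Num.sqrt n%:R *
          (v (e / 2 ^+ k.+1) `^ q^-1 * (e / 2 ^+ k.+2)) +
        net_scale e K * Tb + Bs + eta)%R)].
Proof.
move=> eta0 Hfin q12 C4 v.
have C4' : (0 < K)%N -> [/\ (0 < e)%R, (0 < S)%R & forall f g, Fr0 f -> Fr0 g ->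
     Orlicz_norm mu q (fun z => (rk f - rk g) - (loss ell f z - loss ell g z))%R
       <= (S * psi f g)%:E].
  move=> /C4[e0 S0 hO]; split; [exact: e0|exact: S0|move=> f g Qf Qg].
  have -> : (fun z => (rk f - rk g) - (loss ell f z - loss ell g z))%R =
    (fun z => fine 'E_mu[zdiff ell f g] - zdiff ell f g z)%R.
    by rewrite Ezdiff; [|by left|by left].
  by rewrite EFinM; exact: hO.
have ev := multiscale_bound hn hD mloss (fun f z => hell _ _) intL hpsiQ mG hG
  (ltW hrpos) hr1 htheta C5' C3ae eta0 hgamma0 hgamma1 Hfin q12 C4'.
have lipev := with_prob_ge_lipschitz hD C3ae.
have all := with_prob_geI (with_prob_geI (with_prob_geI C1 C2)
  (with_prob_geI C3T lipev)) ev.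
apply: with_prob_geW (with_prob_geS _ all); first by lra.
move=> w [[[/= [hatn nF] inf_le] [/= GT lw]] /= bound].
have [Fnf erm] := hfn (D w).
split; first exact: nF.
move=> Qf; have := bound lw Tb hTb _ _ Qf; rewrite -/v.
have -> : sample_mean G (D w) = (n%:R^-1 * \sum_(i < n) G (tnth (D w) i))%R by [].
move: GT; rewrite {1}unlock => GT /(_ GT).
(* Each [g] in [Fhat] competes in the minimization over [Fn]; after the nonnegative penalty of [fn]
   is dropped, the empirical excess risk is at most the left side of (C2). *)
have : (sample_mean (loss ell (fn (D w))) (D w) -
        sample_mean (loss ell fs) (D w) <= Bs)%R.
  set Rn := sample_mean (loss ell (fn (D w))) (D w).
  set Rs := sample_mean (loss ell fs) (D w).
  have b0 := hbeta Fnf.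
  rewrite -lee_fin; apply: le_trans inf_le.
  apply: (@le_trans _ _ ((Rn + beta (D w) (fn (D w)) - Rs - alpha (D w))%:E + (alpha (D w))%:E)).
    by rewrite -EFinD lee_fin; lra.
  rewrite leeD2r//; apply: le_ereal_inf_tmp => _ [g hg <-]; rewrite lee_fin.
  have gle : ereal_inf [set (emp_risk ell (D w) g + beta (D w) g)%:E | g in Fn (D w)]
      <= (emp_risk ell (D w) g + beta (D w) g)%:E.
    by apply: ereal_inf_lbound; exists g => //; exact: hatn.
  have := le_trans erm (leeD gle (lexx (alpha (D w))%:E)).
  rewrite -EFinD lee_fin /emp_excess -[emp_risk ell (D w) (fn (D w))]/Rn
    -[emp_risk ell (D w) fs]/Rs; lra.
lra.
Qed.

(** In [Fr0] the hypothesis is divided by [r], turning the slack [r * eta] into [eta]; outside, the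
    excess risk is at most [r0 / n] by definition and the other terms are nonnegative. *)
Lemma excess_le_bound (f : X -> R) (a i eta eps delta q : R) (S : \bar R) :
  (0 <= delta)%R -> (0 <= eta)%R -> (0 <= a)%R -> (0 <= i)%R ->
  a%:E <= theta%:E * ((entropy psi eps Fr0 + (ln (4 / gamma))%:E) * (n%:R^-1)%:E) ->
  i%:E <= 32%:E * S * ((Num.sqrt n%:R)^-1)%:E *
    \int[lebesgue_measure]_(z in `[delta, eps])
      (poweR (2%:E * entropy psi z Fr0 + (ln (32 * eps / (z * gamma)))%:E) q^-1) ->
  F f -> (Fr0 f -> (r * (rk f - rk fs) <= a + i + 8 * delta * Tb + Bs + r * eta)%R) ->
  excess_risk ell mu Fs f <=
    excess_bound psi Fr0 n gamma r0 Bs Tb r theta S q eps delta + eta%:E.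
Proof.
move=> d0 eta0 a0 i0 ha hi Ff hf.
have hb : (r^-1 * (a + i + 8 * delta * Tb + Bs) + r0 / n%:R)%:E <=
    excess_bound psi Fr0 n gamma r0 Bs Tb r theta S q eps delta.
  by rewrite EFinD EFinM !EFinD; exact: excess_bound_ge.
apply: (@le_trans _ _ ((r^-1 * (a + i + 8 * delta * Tb + Bs) + r0 / n%:R) + eta)%:E); last first.
  by rewrite EFinD leeD2r.
have rn0 : (0 <= r0 / n%:R)%R by rewrite divr_ge0.
have [Qf|nQf] := pselect (Fr0 f).
  rewrite (excess_riskE _ hfs) -(fineK (_ : risk ell mu f \is a fin_num)); last first.
    by rewrite ge0_fin_numE ?risk_ge0// risk_lty.
  rewrite -(fineK (_ : risk ell mu fs \is a fin_num)); last first.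
    by rewrite ge0_fin_numE ?risk_ge0.
  rewrite -EFinB lee_fin -/(rk f) -/(rk fs).
  have : (rk f - rk fs <= r^-1 * (a + i + 8 * delta * Tb + Bs + r * eta))%R.
    by rewrite ler_pdivlMl// hf.
  rewrite mulrDr mulKf ?gt_eqF//; lra.
have : excess_risk ell mu Fs f <= (r0 / n%:R)%:E.
  by rewrite leNgt; apply/negP => ex; apply: nQf; rewrite hFr0.
move/le_trans; apply; rewrite lee_fin.
have : (0 <= r^-1 * (a + i + 8 * delta * Tb + Bs))%R.
  by rewrite mulr_ge0 ?invr_ge0 ?(ltW hrpos)// !addr_ge0// !mulr_ge0.
lra.
Qed.

Let gamma4 : (0 <= ln (4 / gamma))%R.
Proof.
have g1 := hgamma1; apply: ln_ge0; rewrite ler_pdivlMr// mul1r.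
by apply: le_trans (ltW g1) _; rewrite ler1n.
Qed.

Let net_term eps :=
  theta%:E * ((entropy psi eps Fr0 + (ln (4 / gamma))%:E) * (n%:R^-1)%:E).

Let integrand eps q z :=
  poweR (2%:E * entropy psi z Fr0 + (ln (32 * eps / (z * gamma)))%:E) q^-1.

Let chain_term S q eps delta := 32%:E * S * ((Num.sqrt n%:R)^-1)%:E *
  \int[lebesgue_measure]_(z in `[delta, eps]) integrand eps q z.

Let net_term_ge0 eps : 0 <= net_term eps.
Proof.
rewrite mule_ge0 ?lee_fin ?(ltW htheta)// mule_ge0 ?lee_fin//.
by rewrite adde_ge0 ?entropy_ge0.
Qed.

Let integral_ge0' q eps delta :
  0 <= \int[lebesgue_measure]_(z in `[delta, eps]) integrand eps q z.
Proof. by apply: integral_ge0 => z _; exact: poweR_ge0. Qed.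

Let sqrt_ge0 : (0 <= (Num.sqrt n%:R)^-1 :> R)%R.
Proof. by rewrite invr_ge0 sqrtr_ge0. Qed.

Let chain_term_ge0 S q eps delta : 0 < S -> 0 <= chain_term S q eps delta.
Proof.
move=> S0; apply: mule_ge0; last exact: integral_ge0'.
by apply: mule_ge0; [apply: mule_ge0; [|exact: ltW]|].
Qed.

Let bound_pinfty S q eps delta : 0 < S ->
  net_term eps = +oo \/ chain_term S q eps delta = +oo ->
  excess_bound psi Fr0 n gamma r0 Bs Tb r theta S q eps delta = +oo.
Proof.
move=> S0 h; rewrite /excess_bound -/(integrand _ _) -/(net_term eps) -/(chain_term S q eps delta).
have hc := chain_term_ge0 q eps delta S0; have hn' := net_term_ge0 eps.
have -> : net_term eps + chain_term S q eps delta = +oo.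
  case: h => ->; first by rewrite addye// gt_eqF// (lt_le_trans _ hc)// ltNy0.
  by rewrite addey// gt_eqF// (lt_le_trans _ hn')// ltNy0.
by rewrite !addye// gt0_muley ?lte_fin ?invr_gt0.
Qed.

Let net_termE eps : entropy psi eps Fr0 < +oo ->
  (theta * ((fine (entropy psi eps Fr0) + ln (4 / gamma)) / n%:R))%:E = net_term eps.
Proof.
move=> Hfin; rewrite /net_term -[X in _ * ((X + _) * _)]fineK.
  by rewrite -EFinD -!EFinM.
by rewrite ge0_fin_numE ?entropy_ge0.
Qed.

Let net_term_lty eps : net_term eps < +oo -> entropy psi eps Fr0 < +oo.
Proof.
rewrite !ltey; apply: contra_neq => H.
rewrite /net_term H addye// gt0_mulye ?lte_fin ?invr_gt0 ?ltr0n//.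
by rewrite gt0_muley ?lte_fin.
Qed.

(** A net without chaining: its radius is [2 * eps], at most [8 * delta]. The nonnegative chain term
    is discarded, which covers [S = +oo]; an infinite entropy makes the bound trivial. *)
Lemma single_scale_bound S q eps delta : 0 < S -> q = 1%R \/ q = 2%R ->
  (0 <= delta)%R -> (eps <= 4 * delta)%R ->
  with_prob_ge P (1 - gamma)
    [set w | excess_risk ell mu Fs (fn (D w))
             <= excess_bound psi Fr0 n gamma r0 Bs Tb r theta S q eps delta].
Proof.
move=> S0 q12 d0 ed.
have [nlty|] := ltP (net_term eps) +oo; last first.
  rewrite leye_eq => /eqP ny; rewrite bound_pinfty//; last by left.
  apply: with_prob_geS (with_prob_geT P (_ : 1 - gamma <= 1)%R); last by rewrite gerBl ltW.
  by move=> w _ /=; exact: leey.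
have Hfin := net_term_lty nlty.
apply: with_prob_ge_slack => eta eta0.
have ev := @erm_event 0%N eps (r * eta)%R 1%R q (mulr_gt0 hrpos eta0).
apply: with_prob_geS (ev _ q12 _) => [w /= [Ff hf]|k|//]; last first.
  by rewrite leqn0 => /eqP ->; rewrite expr0 divr1.
apply: (@excess_le_bound _
  (theta * ((fine (entropy psi eps Fr0) + ln (4 / gamma)) / n%:R))%R 0%R) => //.
- exact: ltW.
- by rewrite -lee_fin net_termE.
- by rewrite net_termE.
- exact: chain_term_ge0.
move=> /hf; rewrite big_ord0 /net_scale/= => H.
have : (2 * eps * Tb <= 8 * delta * Tb)%R by rewrite ler_wpM2r//; lra.
lra.
Qed.

Let integrand_nonincreasing eps q y z : (0 < q)%R ->
  (0 < y)%R -> (y <= z)%R -> (z <= eps)%R ->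
  integrand eps q z <= integrand eps q y.
Proof.
move=> q0 y0 yz ze; have z0 := lt_le_trans y0 yz.
have e0 := lt_le_trans z0 ze.
have lnzy : (ln (32 * eps / (z * gamma)) <= ln (32 * eps / (y * gamma)))%R.
  rewrite ler_ln ?posrE ?divr_gt0 ?mulr_gt0//.
  rewrite ler_pM2l ?mulr_gt0// lef_pV2 ?posrE ?mulr_gt0//.
  by rewrite ler_pM2r.
have lnz0 : (0 <= ln (32 * eps / (z * gamma)))%R.
  apply: ln_ge0; rewrite ler_pdivlMr ?mulr_gt0// mul1r.
  apply: (@le_trans _ _ z); first by rewrite ler_piMr// ltW.
  by apply: (le_trans ze); rewrite ler_peMl ?(ltW e0)//; lra.
have H0 x : 0 <= 2%:E * entropy psi x Fr0 by rewrite mule_ge0 ?entropy_ge0.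
apply: gt0_ler_poweR.
- by rewrite invr_ge0 ltW.
- by rewrite in_itv/= leey andbT adde_ge0.
- by rewrite in_itv/= leey andbT adde_ge0// lee_fin (le_trans lnz0).
- by rewrite leeD// lee_wpmul2l// entropy_nonincreasing.
Qed.

Let integrandE eps q z : entropy psi z Fr0 < +oo ->
  integrand eps q z =
  ((2 * fine (entropy psi z Fr0) + ln (32 * eps / (z * gamma))) `^ q^-1)%:E.
Proof.
move=> Hfin; rewrite /integrand -[X in 2%:E * X]fineK.
  by rewrite -EFinM -EFinD poweR_EFin.
by rewrite ge0_fin_numE ?entropy_ge0.
Qed.

Let integrand_lty eps q z : (0 < q)%R -> integrand eps q z < +oo ->
  entropy psi z Fr0 < +oo.
Proof.
move=> q0; rewrite /integrand => /lty_poweRy; rewrite invr_eq0 gt_eqF// => /(_ isT).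
rewrite !ltey; apply: contra_neq => ->.
by rewrite gt0_muley// addye.
Qed.

Let integrand_gt0 eps q z : (0 < z)%R -> (z <= eps)%R ->
  0 < integrand eps q z.
Proof.
move=> z0 ze; apply: poweR_gt0.
apply: (@lt_le_trans _ _ (ln (32 * eps / (z * gamma)))%:E); last first.
  by rewrite leeDr// mule_ge0 ?entropy_ge0.
rewrite lte_fin ln_gt0// ltr_pdivlMr ?mulr_gt0// mul1r.
apply: (@lt_le_trans _ _ z); first by rewrite gtr_pMr.
by have := lt_le_trans z0 ze; lra.
Qed.

(** For [delta > 0] the first scale below [4 * delta] is taken; the scale before it is at least
    [4 * delta], so a quarter of that is still at least [delta]. For [delta = 0] a scale
    contributing at most [eta] is taken. *)
Let scale_exists eps delta eta : (0 <= delta)%R -> (4 * delta < eps)%R -> (0 < eta)%R ->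
  exists2 K : nat, (0 < K)%N & (delta <= eps / 2 ^+ K.+1)%R /\
    (net_scale eps K * Tb <= 8 * delta * Tb + eta)%R.
Proof.
move=> d0 ed eta0; have e0 : (0 < eps)%R by lra.
have [dp|] := ltP 0%R delta; last first.
  move=> dle; have {dle}-> : delta = 0%R by apply: le_anti; rewrite dle.
  have T1 : (0 < Tb + 1)%R by have := hTb; lra.
  have [m hm] := exists_half_pow_lt eps (divr_gt0 eta0 T1).
  exists m.+1 => //; split; first by rewrite divr_ge0 ?exprn_ge0// ltW.
  rewrite mulr0 mul0r add0r /net_scale/=.
  have hm' : (eps / 2 ^+ m.+1 <= eta / (Tb + 1))%R.
    by apply: le_trans (ltW hm); exact: ler_half_pow.
  apply: (@le_trans _ _ (eta / (Tb + 1) * Tb)%R); first by rewrite ler_wpM2r.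
  by rewrite mulrAC ler_pdivrMr// ler_wpM2l ?(ltW eta0)//; lra.
have ex : exists m, (eps / 2 ^+ m < 4 * delta)%R by apply: exists_half_pow_lt; lra.
case: (ex_minnP ex) => -[|m] hm minm; first by move: hm; rewrite expr0 divr1; lra.
exists m.+1 => //.
have hm2 : (4 * delta <= eps / 2 ^+ m)%R.
  by rewrite leNgt; apply/negP => /minm; rewrite ltnn.
split.
  have -> : (eps / 2 ^+ m.+2 = eps / 2 ^+ m / 4)%R.
    by rewrite !exprS; field; rewrite expf_neq0.
  lra.
rewrite /net_scale/=.
have : (eps / 2 ^+ m.+1 * Tb <= 4 * delta * Tb)%R by rewrite ler_wpM2r// ltW.
have : (0 <= delta * Tb)%R by rewrite mulr_ge0.
lra.
Qed.

(** An infinite bound is trivial. A finite one makes the dyadic lower sum of the integral finite,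
    hence also the entropies at all scales used, and [erm_event] applies. *)
Lemma multi_scale_bound S q eps delta : 0 < S -> q = 1%R \/ q = 2%R ->
  (forall f g, Fr0 f -> Fr0 g ->
     Orlicz_norm mu q (fun z => fine 'E_mu[zdiff ell f g] - zdiff ell f g z)%R
       <= S * (psi f g)%:E) ->
  (0 <= delta)%R -> (4 * delta < eps)%R ->
  with_prob_ge P (1 - gamma)
    [set w | excess_risk ell mu Fs (fn (D w))
             <= excess_bound psi Fr0 n gamma r0 Bs Tb r theta S q eps delta].
Proof.
move=> S0 q12 C4 d0 de; have e0 : (0 < eps)%R by lra.
have q0 : (0 < q)%R by case: q12 => ->.
have sn0 : (0 < (Num.sqrt n%:R)^-1 :> R)%R by rewrite invr_gt0 sqrtr_gt0 ltr0n.
have trivial_case : net_term eps = +oo \/ chain_term S q eps delta = +oo ->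
    with_prob_ge P (1 - gamma)
    [set w | excess_risk ell mu Fs (fn (D w))
             <= excess_bound psi Fr0 n gamma r0 Bs Tb r theta S q eps delta].
  move=> h; rewrite bound_pinfty//.
  apply: with_prob_geS (with_prob_geT P (_ : 1 - gamma <= 1)%R); last by rewrite gerBl ltW.
  by move=> w _ /=; exact: leey.
have [nlty|] := ltP (net_term eps) +oo; last first.
  by rewrite leye_eq => /eqP ny; apply: trivial_case; left.
have [clty|] := ltP (chain_term S q eps delta) +oo; last first.
  by rewrite leye_eq => /eqP ny; apply: trivial_case; right.
have Hfin := net_term_lty nlty.
have v0 z : 0 <= integrand eps q z by exact: poweR_ge0.
have vmono := fun y z => @integrand_nonincreasing eps q y z q0.
have lower K (hK : (delta <= eps / 2 ^+ K.+1)%R) :=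
  dyadic_integral_ge e0 hK v0 vmono.
have coef0 : 0 < 32%:E * S * ((Num.sqrt n%:R)^-1)%:E.
  by rewrite !mule_gt0.
have int_lty : \int[lebesgue_measure]_(z in `[delta, eps]) integrand eps q z < +oo.
  rewrite ltey; apply/eqP => iy.
  by move: clty; rewrite /chain_term iy gt0_muley// ltxx.
have e2 k : (0 < eps / 2 ^+ k)%R by rewrite divr_gt0 ?exprn_gt0.
have ek k : (eps / 2 ^+ k <= eps)%R.
  by have := ler_half_pow e0 (leq0n k); rewrite expr0 divr1.
case: S => [s| |] in S0 C4 clty trivial_case coef0 *; last by [].
  apply: with_prob_ge_slack => eta eta0.
  (* Half of [eta] pays for the last scale, the other half for the slack in [erm_event]. *)
  have [K K0 [dK TK]] := scale_exists d0 de (mulr_gt0 hrpos (divr_gt0 eta0 (ltr0n _ 2))).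
  have Kterm (k : 'I_K) : integrand eps q (eps / 2 ^+ k.+1)%R < +oo.
    rewrite ltey; apply/eqP => iy.
    have := le_lt_trans (lower K dK) int_lty.
    rewrite (bigD1 k)//= iy gt0_mulye ?lte_fin// addye//.
    rewrite gt_eqF// (lt_le_trans ltNy0)// sume_ge0// => j _.
    by rewrite mule_ge0// lee_fin ltW.
  have Hk (k : 'I_K) := integrand_lty q0 (Kterm k).
  have ev := @erm_event K eps (r * (eta / 2))%R s q (mulr_gt0 hrpos (divr_gt0 eta0 (ltr0n _ 2))).
  apply: with_prob_geS (ev _ q12 _) => [w /= [Ff hf]|k|_]; last by split.
    apply: (@excess_le_bound _ (theta * ((fine (entropy psi eps Fr0) + ln (4 / gamma)) / n%:R))%R
      (\sum_(k < K) 32 * s / Num.sqrt n%:R *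
        ((2 * fine (entropy psi (eps / 2 ^+ k.+1) Fr0) +
          ln (32 * eps / (eps / 2 ^+ k.+1 * gamma))) `^ q^-1 * (eps / 2 ^+ k.+2)))%R) => //.
    - exact: ltW.
    - by rewrite -lee_fin net_termE.
    - apply: sumr_ge0 => k _; rewrite !mulr_ge0// ?powR_ge0// ?(ltW (e2 _))//.
        by rewrite -lee_fin ltW.
      exact: ltW.
    - by rewrite net_termE.
    - rewrite -mulr_sumr EFinM !EFinM lee_wpmul2l//; first exact: ltW.
      apply: le_trans (lower K dK); rewrite -sumEFin; apply: lee_sum => k _.
      by rewrite EFinM integrandE.
    by move=> /hf; lra.
  case: k => [|k] kK; first by rewrite expr0 divr1.
  exact: (Hk (Ordinal kK)).
(* For [S = +oo] the integral is positive, its dyadic lower sum having a positive term, so the chain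
   term is infinite, against [clty]. *)
have [K K0 [dK _]] := scale_exists d0 de ltr01.
exfalso; move: clty; rewrite /chain_term.
rewrite [X in X * _](_ : _ = +oo); last by rewrite gt0_muley// gt0_mulye ?lte_fin.
rewrite gt0_mulye ?ltxx//.
apply: lt_le_trans (lower K dK).
rewrite (bigD1 (Ordinal K0))//=
  (@lt_le_trans _ _ (integrand eps q (eps / 2 ^+ 1) * (eps / 2 ^+ 2)%:E))//.
  by rewrite mule_gt0 ?lte_fin// integrand_gt0.
by rewrite leeDl// sume_ge0// => j _; rewrite mule_ge0// lee_fin ltW.
Qed.

End erm.

Theorem theorem1 (R : realType) (X : completeNormedModType R)
  (ip : {dot X for idfun}) (hip : inner_product_norm ip) (hsep : separable X)
  (* the regression problem *)
  (ell : R -> R -> R) (hell : forall y t, (0 <= ell y t)%R)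
  (mell : measurable_fun setT (fun yt : R * R => ell yt.1 yt.2))
  (mu : probability (obs X R) R)
  (Fs : set (X -> R))
  (mFs : forall f, Fs f -> measurable_fun setT (f : borel X -> R))
  (* the sample *)
  (n : nat) (hn : (0 < n)%N)
  (dOmega : measure_display) (Omega : measurableType dOmega)
  (P : probability Omega R)
  (D : Omega -> n.-tuple (obs X R)) (hD : iid_sample P mu D)
  (* the classes, and the estimator *)
  (Fn Fhat : n.-tuple (obs X R) -> set (X -> R))
  (alpha : n.-tuple (obs X R) -> R) (halpha : forall d, (0 <= alpha d)%R)
  (beta : n.-tuple (obs X R) -> (X -> R) -> R)
  (hbeta : forall d f, Fn d f -> (0 <= beta d f)%R)
  (fn : n.-tuple (obs X R) -> X -> R)
  (hfn : forall d, ERM ell (alpha d) (beta d) (Fn d) d (fn d))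
  (F : set (X -> R))
  (mF : forall f, F f -> measurable_fun setT (f : borel X -> R))
  (psi : (X -> R) -> (X -> R) -> R) (hpsi : metric_on F psi)
  (gamma : R) (hgamma0 : (0 < gamma)%R) (hgamma1 : (gamma < 1)%R)
  (fs : X -> R) (hfs : argmin_risk ell mu Fs fs)
  (r0 : R) (hr0 : (0 <= r0)%R)
  (Fr0 : set (X -> R)) (hFr0 : Fr0 = large_excess ell mu Fs F (r0 / n%:R))
  (C1 : with_prob_ge P (1 - gamma / 4)
          [set w | Fhat (D w) `<=` Fn (D w) /\ Fn (D w) `<=` F])
  (Bs : R) (hBs : (0 <= Bs)%R)
  (C2 : with_prob_ge P (1 - gamma / 4)
          [set w | ereal_inf [set (emp_excess ell (D w) f fs + beta (D w) f)%:E
                             | f in Fhat (D w)]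
                   + (alpha (D w))%:E <= Bs%:E])
  (G : obs X R -> R) (hG : forall z, (0 <= G z)%R)
  (mG : measurable_fun setT G)
  (Tb : R) (hTb : (0 <= Tb)%R)
  (* the exceptional null set is the same for all f and g *)
  (C3ae : {ae mu, forall z : obs X R, forall f g, Fr0 f -> Fr0 g ->
             (zdiff ell f g z <= G z * psi f g)%R})
  (C3T : with_prob_ge P (1 - gamma / 4)
           [set w | 'E_mu[G] +
                    (n%:R^-1 * \sum_(i < n) G (tnth (D w) i))%:E <= Tb%:E])
  (r theta : R) (hrpos : (0 < r)%R) (hr1 : (r <= 1)%R) (htheta : (0 < theta)%R)
  (C5 : ereal_sup
          [set \int[mu]_z expeR ((r / theta)%:E * 'E_mu[zdiff ell f fs]
                                 - (theta^-1 * zdiff ell f fs z)%:E)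
          | f in Fr0] <= 1) :
  (forall (S : \bar R) (q : R), 0 < S -> q = 1%R \/ q = 2%R ->
     (* (C4); the expectation is finite on Fr0 by (C5) *)
     (forall f g, Fr0 f -> Fr0 g ->
        Orlicz_norm mu q
          (fun z => (fine 'E_mu[zdiff ell f g] - zdiff ell f g z)%R)
        <= S * (psi f g)%:E) ->
     forall eps delta : R, (0 <= delta)%R -> (delta <= eps)%R ->
       with_prob_ge P (1 - gamma)
         [set w | excess_risk ell mu Fs (fn (D w))
                  <= excess_bound psi Fr0 n gamma r0 Bs Tb r theta S q
                       eps delta])
  /\
  (forall q : R, q = 1%R \/ q = 2%R ->
     forall delta : R, (0 <= delta)%R ->
       with_prob_ge P (1 - gamma)
         [set w | excess_risk ell mu Fs (fn (D w))
                  <= excess_bound psi Fr0 n gamma r0 Bs Tb r theta +oo q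
                       delta delta]).
Proof.
(* If [fs] has infinite risk, every excess risk is [-oo] by convention and both bounds hold. *)
have [rfs|rfs] := ltP (risk ell mu fs) +oo; last first.
  have bound b : with_prob_ge P (1 - gamma)
      [set w | excess_risk ell mu Fs (fn (D w)) <= b].
    apply: with_prob_geS (with_prob_geT P (_ : 1 - gamma <= 1)%R).
      move=> w _ /=; rewrite (excess_riskE _ hfs).
      by move: rfs; rewrite leye_eq => /eqP ->; rewrite addeNy leNye.
    by rewrite gerBl ltW.
  by split => *; exact: bound.
have single := single_scale_bound hell mell mFs hn hD hbeta hfn mF hpsi
  hgamma0 hgamma1 hfs hr0 hFr0 C1 hBs C2 hG mG hTb C3ae C3T hrpos hr1 htheta C5 rfs.
have multi := multi_scale_bound hell mell mFs hn hD hbeta hfn mF hpsi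
  hgamma0 hgamma1 hfs hr0 hFr0 C1 hBs C2 hG mG hTb C3ae C3T hrpos hr1 htheta C5 rfs.
split=> [S q S0 q12 C4 eps delta d0 de|q q12 delta d0].
  (* For [eps < 4 * delta] even one link would need the piece []eps / 4, eps / 2]], which reaches
     below [delta]. *)
  by have [le4|lt4] := leP eps (4 * delta)%R; [exact: single|exact: multi].
by apply: single => //; lra.
Qed.
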